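(* Let $\varphi$ be an endomorphism of a subshift $(X,\sigma)$. Let $i\in\mathbb N$ and $j\in\mathbb Z$. If $\varphi$ is onto, then the following (1), (2), (3) hold. (1) $\varphi$ is essentially weakly $p$-L and right $\sigma$-expansive if and only if $p_L(\varphi)>0$; moreover $\varphi^i\sigma^j$ is essentially weakly $p$-L and right $\sigma$-expansive if and only if $j/i>-p_L(\varphi)$. Likewise, $\varphi$ is essentially weakly $p$-R and left $\sigma$-expansive if and only if $p_R(\varphi)>0$; moreover $\varphi^i\sigma^j$ is essentially weakly $p$-R and left $\sigma$-expansive if and only if $j/i<p_R(\varphi)$. (2) $\varphi$ is essentially weakly $q$-R and left $\sigma$-expansive if and only if $q_R(\varphi)>0$; moreover $\varphi^i\sigma^j$ is essentially weakly $q$-R and left $\sigma$-expansive if and only if $j/i>-q_R(\varphi)$. Likewise, $\varphi$ is essentially weakly $q$-L and right $\sigma$-expansive if and only if $q_L(\varphi)>0$; moreover $\varphi^i\sigma^j$ is essentially weakly $q$-L and right $\sigma$-expansive if and only if $j/i<q_L(\varphi)$. (3) If $(X,\sigma)$ is an SFT, then (1) holds with every ''weakly'' deleted; if in addition $\varphi$ is one-to-one or $\sigma$ is topologically transitive, then (2) holds with every ''weakly'' deleted. If $\varphi$ is not necessarily onto, then: (4) $\varphi$ is positively left $\sigma$-expansive if and only if $q_R(\varphi)>0$; moreover $\varphi^i\sigma^j$ is positively left $\sigma$-expansive if and only if $j/i>-q_R(\varphi)$. Likewise, $\varphi$ is positively right $\sigma$-expansive if and only if $q_L(\varphi)>0$;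 moreover $\varphi^i\sigma^j$ is positively right $\sigma$-expansive if and only if $j/i<q_L(\varphi)$.
   Context: **Subshifts.** $\mathbb N=\{1,2,\dots\}$. An alphabet is a finite set with at least two elements. For an alphabet $A$, $A^{\mathbb Z}$ carries the product topology; the shift maps $(a_j)_j$ to $(a_{j+1})_j$. A subshift $(X,\sigma)$ over $A$ is a closed $X\subset A^{\mathbb Z}$ with $\sigma(X)=X$, $\sigma$ being the restricted shift; $d_X$ is a compatible metric; $L_k(X)$ is the set of words of length $k$ occurring in points of $X$. An endomorphism of $(X,\sigma)$ is a continuous map $\varphi:X\to X$ commuting with $\sigma$ (not assumed onto). **Type.** A local rule of neighborhood-size $N\ge 0$ on $X$ is a map $f:L_{N+1}(X)\to L_1(X)$ with $(f(a_j\dots a_{j+N}))_{j\in\mathbb Z}\in X$ for all $(a_j)\in X$. For $m,n\ge0$, $m+n=N$, $\varphi$ is of $(m,n)$-type given by $f$ if $\varphi((a_j)_j)=(f(a_{j-m}\dots a_{j+n}))_j$. Every endomorphism arises this way. **Degrees.** Let $f$ be a local rule of neighborhood-size $N$. It is $I$ left-redundant ($I\ge0$) if for all $(a_j),(b_j)\in X$, $a_j=b_j$ for all $j\ge0$ implies $f(a_{-I}\dots a_{-I+N})=f(b_{-I}\dots b_{-I+N})$; $I$ right-redundant if $a_j=b_j$ for all $j\le0$ implies $f(a_{I-N}\dots a_I)=f(b_{I-N}\dots b_I)$. It is strictly $I$ left-redundant if $I$ left-redundant but not $I+1$ left-redundant, strictly $\infty$ left-redundant if $I$ left-redundant for all $I\ge0$;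 similarly for right. It is $k$ right-mergible ($k\ge0$) if $a_j=b_j$ for $j\le 0$ and $f(a_{j-N}\dots a_j)=f(b_{j-N}\dots b_j)$ for $1\le j\le k+1$ imply $a_1=b_1$; $k$ left-mergible if $a_j=b_j$ for $j\ge0$ and $f(a_{-j}\dots a_{-j+N})=f(b_{-j}\dots b_{-j+N})$ for $1\le j\le k+1$ imply $a_{-1}=b_{-1}$. It is strictly $k$ right-mergible if $k\ge 0$ is the least integer for which it is $k$ right-mergible, strictly $\infty$ right-mergible if there is none; similarly for left. If $\varphi$ is of $(m,n)$-type given by $f$ which is strictly $I$ left-redundant, strictly $J$ right-redundant, strictly $k$ right-mergible and strictly $l$ left-mergible, then $P_L(\varphi)=I-m$, $P_R(\varphi)=J-n$, and, if $X$ is infinite, $Q_R(\varphi)=n-k$, $Q_L(\varphi)=m-l$; if $X$ is finite, $Q_R(\varphi)=Q_L(\varphi)=\infty$. These are independent of the choice of $f$, $m$, $n$. **Limits.** $p_L(\varphi)=\lim_{s\to\infty}P_L(\varphi^s)/s$, $p_R(\varphi)=\lim_{s\to\infty} P_R(\varphi^s)/s$, $q_R(\varphi)=\lim_{s\to\infty} Q_R(\varphi^s)/s$, $q_L(\varphi)=\lim_{s\to\infty} Q_L(\varphi^s)/s$; these limits exist in $\mathbb R\cup\{\pm\infty\}$. **Graphs.** A graph is a finite directed graph $G$ (multiple arcs, loops allowed) with arc-set $A_G$, vertex-set $V_G$ and initial/terminal vertex maps $i_G,t_G:A_G\to V_G$; it is nondegenerate if $i_G,t_G$ are onto. $X_G\subset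 A_G^{\mathbb Z}$ is the set of bi-infinite paths ($t_G(a_j)=i_G(a_{j+1})$ for all $j$) and $\sigma_G$ its shift; for $G$ nondegenerate, $(X_G,\sigma_G)$ is called a topological Markov shift. An SFT is a subshift topologically conjugate to a topological Markov shift. A graph-homomorphism $h=(h_A,h_V):\Gamma\to G$ is a pair of maps on arcs and vertices compatible with $i,t$; it induces $\phi_h:X_\Gamma\to X_G$, $(\alpha_j)\mapsto(h_A(\alpha_j))$. $h$ is weakly left-resolving (resp. weakly right-resolving) if every arc $\alpha$ of $\Gamma$ is uniquely determined by $t_\Gamma(\alpha)$ (resp. $i_\Gamma(\alpha)$) and $h_A(\alpha)$; it is left-resolving (resp. right-resolving) if for every $u\in V_\Gamma$, $a\in A_G$ with $t_G(a)=h_V(u)$ (resp. $i_G(a)=h_V(u)$) there is a unique $\alpha\in A_\Gamma$ with $h_A(\alpha)=a$ and $t_\Gamma(\alpha)=u$ (resp. $i_\Gamma(\alpha)=u$). **Resolving endomorphisms.** A textile system $T=(p,q:\Gamma\to G)$ is a pair of graph-homomorphisms $p,q:\Gamma\to G$. $T$ is (weakly) $p$-L, $p$-R, $q$-L, $q$-R if respectively $p$ is (weakly) left-resolving, $p$ is (weakly) right-resolving, $q$ is (weakly) left-resolving, $q$ is (weakly) right-resolving. For each such term $\mathcal P$: an endomorphism $\varphi$ of a subshift $(X,\sigma)$ is weakly $\mathcal P$ if there are a weakly $\mathcal P$ textile system $T=(p,q:\Gamma\to G)$ and a closed shift-invariant $Z\subset X_\Gamma$ such that $\phi_p|_Z$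 is injective, $\phi_p(Z)=X$, $\phi_q(Z)\subset X$ and $\varphi=\phi_q\circ(\phi_p|_Z)^{-1}$. An onto endomorphism $\varphi$ of a topological Markov shift $(X_G,\sigma_G)$ is $\mathcal P$ if there is a $\mathcal P$ textile system $T=(p,q:\Gamma\to G)$ such that, with $Z_T$ the set of $z\in X_\Gamma$ for which there is $(z_i)_{i\in\mathbb Z}$ in $X_\Gamma$ with $z_0=z$ and $\phi_q(z_{i-1})=\phi_p(z_i)$ for all $i$, one has $\phi_p(Z_T)=X_G$, $\phi_p|_{Z_T}$ is injective and $\varphi=\phi_q\circ(\phi_p|_{Z_T})^{-1}$. An endomorphism $\varphi$ of $(X,\sigma)$ is essentially weakly $\mathcal P$ (resp. an onto endomorphism of an SFT is essentially $\mathcal P$) if there are a subshift (resp. topological Markov shift) $(X',\sigma')$, a weakly $\mathcal P$ (resp. $\mathcal P$) endomorphism $\varphi'$ of it and a homeomorphism $\theta:X\to X'$ with $\theta\sigma=\sigma'\theta$, $\theta\varphi=\varphi'\theta$. **Expansiveness.** A $\varphi$-orbit is a sequence $(x_i)_{i\in\mathbb Z}$ with $\varphi(x_i)=x_{i+1}$. An onto endomorphism $\varphi$ is left (resp. right) $\sigma$-expansive if there is $\delta>0$ such that for any $\varphi$-orbits $(x_i),(y_i)$, $d_X(\sigma^j(x_i),\sigma^j(y_i))\le\delta$ for all $i\in\mathbb Z$ and all $j\le0$ (resp. $j\ge0$) implies $(x_i)=(y_i)$. An endomorphism $\varphi$ is positively left (resp. right) $\sigma$-expansive if there is $\delta>0$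 such that for $x,y\in X$, $d_X(\sigma^j\varphi^i(x),\sigma^j\varphi^i(y))\le\delta$ for all $i\ge0$ and $j\le0$ (resp. $j\ge0$) implies $x=y$. *)

(* Defs.v *)
From HB Require Import structures.
From mathcomp Require Import all_boot all_order all_algebra.
From mathcomp Require Import all_classical all_reals.
From mathcomp Require Import ereal topology normedtype sequences.

Set Implicit Arguments.
Unset Strict Implicit.
Unset Printing Implicit Defensive.

Import Order.TTheory GRing.Theory Num.Theory.
Local Open Scope classical_set_scope.
Local Open Scope ring_scope.

Definition fullshift (A : finType) : topologicalType :=
  {ptws int -> discrete_topology A}.

(* [shift k] is the [k]-th power of the shift map [(a_j) |-> (a_(j+1))]. *)
Definition shift (A : finType) (k : int) (a : fullshift A) : fullshift A :=
  fun j => a (j + k).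

(* Alphabets are required to have at least two elements where subshifts are
   quantified over, and not here, because the arc-set of the graph of a
   topological Markov shift may be smaller. *)
Record subshift (A : finType) := Subshift {
  points :> set (fullshift A);
  subshift_closed : closed points;
  subshift_shift : shift 1 @` points = points
}.

Lemma subshift_inv (A : finType) (X : subshift A) (k : int) (a : fullshift A) :
  points X a -> points X (shift k a).
Proof.
have sD (b : fullshift A) m n : shift m (shift n b) = shift (m + n) b.
  by apply/funext => j; rewrite /shift addrA.
have s0 (b : fullshift A) : shift 0 b = b.
  by apply/funext => j; rewrite /shift addr0.
have s1 b : points X b -> points X (shift 1 b).
  by move=> Xb; rewrite -(subshift_shift X); exists b.
have sN1 b : points X b -> points X (shift (-1) b).
  by rewrite -{1}(subshift_shift X) => -[c Xc <-]; rewrite sD addNr s0.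
elim/int_rec: k a => [|n IH|n IH] a Xa; first by rewrite s0.
  by rewrite -addn1 PoszD addrC -sD; apply/s1/IH.
by rewrite -addn1 PoszD opprD addrC -sD; apply/sN1/IH.
Qed.

(* [sigma X k] is the [k]-th power of the restricted shift of [X]. *)
Definition sigma (A : finType) (X : subshift A) (k : int) (x : X) : X :=
  SigSub (mem_set (subshift_inv k (set_mem (valP x)))).

Definition endomorphism (A : finType) (X : subshift A) (phi : X -> X) : Prop :=
  continuous phi /\ forall x, phi (sigma 1 x) = sigma 1 (phi x).

Definition onto (T U : Type) (f : T -> U) : Prop := forall y, exists x, f x = y.

Definition homeomorphism (T U : topologicalType) (h : T -> U) : Prop :=
  continuous h /\ exists g : U -> T, [/\ continuous g, cancel h g & cancel g h].

Definition conjugacy (A B : finType) (X : subshift A) (Y : subshift B)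
    (theta : X -> Y) : Prop :=
  homeomorphism theta /\ forall x, theta (sigma 1 x) = sigma 1 (theta x).

(* Taking [n] nonnegative makes a transitive SFT one whose graph can be chosen
   strongly connected, which [n] in [int] would not. *)
Definition topologically_transitive (A : finType) (X : subshift A) : Prop :=
  forall U V : set X, open U -> open V -> U !=set0 -> V !=set0 ->
    exists n : nat, (@sigma A X n%:Z @` U) `&` V !=set0.

(* The word [a_s ... a_(s+N)]. *)
Definition word (A : finType) (N : nat) (a : fullshift A) (s : int) :
  N.+1.-tuple A := [tuple a (s + k%:Z) | k < N.+1].

Section Degrees.
Variables (A : finType) (X : subshift A).

(* A local rule is a map on the words of length [N.+1] of [X]; it is represented
   by a map on all words, whose values outside of these are never consulted.
   That it takes its values in the set of symbols of [X] follows. *)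
Definition local_rule (N : nat) (f : N.+1.-tuple A -> A) : Prop :=
  forall x : X, points X (fun j => f (word N (\val x) j)).

Definition of_type (m n : nat) (f : (m + n).+1.-tuple A -> A) (phi : X -> X) :
    Prop :=
  local_rule f /\
  forall (x : X) (j : int), \val (phi x) j = f (word (m + n) (\val x) (j - m%:Z)).

Variables (N : nat) (f : N.+1.-tuple A -> A).

Definition left_redundant (I : nat) : Prop := forall x y : X,
  (forall j : int, 0 <= j -> \val x j = \val y j) ->
  f (word N (\val x) (- I%:Z)) = f (word N (\val y) (- I%:Z)).

Definition right_redundant (I : nat) : Prop := forall x y : X,
  (forall j : int, j <= 0 -> \val x j = \val y j) ->
  f (word N (\val x) (I%:Z - N%:Z)) = f (word N (\val y) (I%:Z - N%:Z)).

Definition right_mergible (k : nat) : Prop := forall x y : X,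
  (forall j : int, j <= 0 -> \val x j = \val y j) ->
  (forall j : nat, (1 <= j <= k.+1)%N ->
    f (word N (\val x) (j%:Z - N%:Z)) = f (word N (\val y) (j%:Z - N%:Z))) ->
  \val x 1 = \val y 1.

Definition left_mergible (k : nat) : Prop := forall x y : X,
  (forall j : int, 0 <= j -> \val x j = \val y j) ->
  (forall j : nat, (1 <= j <= k.+1)%N ->
    f (word N (\val x) (- j%:Z)) = f (word N (\val y) (- j%:Z))) ->
  \val x (-1) = \val y (-1).

(* In the following four definitions, [None] stands for infinity. *)
Definition strictly_left_redundant (I : option nat) : Prop :=
  if I is Some n then left_redundant n /\ ~ left_redundant n.+1
  else forall n, left_redundant n.

Definition strictly_right_redundant (I : option nat) : Prop :=
  if I is Some n then right_redundant n /\ ~ right_redundant n.+1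
  else forall n, right_redundant n.

Definition strictly_right_mergible (k : option nat) : Prop :=
  if k is Some n
  then right_mergible n /\ forall n', right_mergible n' -> (n <= n')%N
  else forall n, ~ right_mergible n.

Definition strictly_left_mergible (k : option nat) : Prop :=
  if k is Some n
  then left_mergible n /\ forall n', left_mergible n' -> (n <= n')%N
  else forall n, ~ left_mergible n.

End Degrees.

Section Limits.
Variables (R : realType) (A : finType) (X : subshift A).
Local Open Scope ereal_scope.

Definition ext (k : option nat) : \bar R := if k is Some n then n%:R%:E else +oo.

(* [P_L phi], ..., [Q_L phi] are the unique elements of these sets. *)
Definition P_L_spec (phi : X -> X) : set (\bar R) := [set v | exists m n f I,
  [/\ @of_type A X m n f phi, strictly_left_redundant X f I
    & v = ext I - m%:R%:E]].

Definition P_R_spec (phi : X -> X) : set (\bar R) := [set v | exists m n f J,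
  [/\ @of_type A X m n f phi, strictly_right_redundant X f J
    & v = ext J - n%:R%:E]].

Definition Q_R_spec (phi : X -> X) : set (\bar R) := [set v |
  (finite_set (points X) /\ v = +oo) \/
  (infinite_set (points X) /\ exists m n f k,
    [/\ @of_type A X m n f phi, strictly_right_mergible X f k
      & v = n%:R%:E - ext k])].

Definition Q_L_spec (phi : X -> X) : set (\bar R) := [set v |
  (finite_set (points X) /\ v = +oo) \/
  (infinite_set (points X) /\ exists m n f l,
    [/\ @of_type A X m n f phi, strictly_left_mergible X f l
      & v = m%:R%:E - ext l])].

Definition P_L (phi : X -> X) : \bar R := xget 0 (P_L_spec phi).
Definition P_R (phi : X -> X) : \bar R := xget 0 (P_R_spec phi).
Definition Q_R (phi : X -> X) : \bar R := xget 0 (Q_R_spec phi).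
Definition Q_L (phi : X -> X) : \bar R := xget 0 (Q_L_spec phi).

Definition p_L (phi : X -> X) : \bar R :=
  lim ((fun s : nat => P_L (iter s phi) * (s%:R^-1)%:E) @ \oo).
Definition p_R (phi : X -> X) : \bar R :=
  lim ((fun s : nat => P_R (iter s phi) * (s%:R^-1)%:E) @ \oo).
Definition q_R (phi : X -> X) : \bar R :=
  lim ((fun s : nat => Q_R (iter s phi) * (s%:R^-1)%:E) @ \oo).
Definition q_L (phi : X -> X) : \bar R :=
  lim ((fun s : nat => Q_L (iter s phi) * (s%:R^-1)%:E) @ \oo).

End Limits.

(* A graph with arc-set [A]. *)
Record graph (A : finType) := Graph {
  vertex : finType;
  init : A -> vertex;
  term : A -> vertex
}.

Definition nondegenerate (A : finType) (G : graph A) : Prop :=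
  onto (@init A G) /\ onto (@term A G).

Definition paths (A : finType) (G : graph A) : set (fullshift A) :=
  [set a | forall j : int, term G (a j) = init G (a (j + 1))].

Lemma paths_closed (A : finType) (G : graph A) : closed (paths G).
Proof.
move=> a clPa j.
have ev k : nbhs a [set b : fullshift A | b k = a k].
  have : {for a, continuous (fun b : fullshift A => b k)}.
    exact: (@proj_continuous int (fun=> discrete_topology A) k a).
  move=> /(_ [set a k]) /=; apply.
  exact: (@discrete_set1 (discrete_topology A)).
have [b [Pb [/= <- <-]]] := clPa _ (filterI (ev j) (ev (j + 1))).
exact: Pb.
Qed.

Lemma paths_shift (A : finType) (G : graph A) : shift 1 @` paths G = paths G.
Proof.
apply/seteqP; split=> [_ [a Pa <-] j|a Pa]; first by rewrite /shift Pa.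
exists (shift (-1) a); first by move=> j; rewrite /shift Pa addrAC.
by apply/funext => j; rewrite /shift addrK.
Qed.

(* The subshift [(X_G, sigma_G)]; it is a topological Markov shift when [G] is
   nondegenerate. *)
Definition path_shift (A : finType) (G : graph A) : subshift A :=
  Subshift (@paths_closed A G) (@paths_shift A G).

Definition SFT (A : finType) (X : subshift A) : Prop :=
  exists (B : finType) (G : graph B) (theta : X -> path_shift G),
    nondegenerate G /\ conjugacy theta.

Record graph_hom (B A : finType) (Gamma : graph B) (G : graph A) := GraphHom {
  on_arc :> B -> A;
  on_vertex : vertex Gamma -> vertex G;
  hom_init : forall b, init G (on_arc b) = on_vertex (init Gamma b);
  hom_term : forall b, term G (on_arc b) = on_vertex (term Gamma b)
}.

Section Resolving.
Variables (B A : finType) (Gamma : graph B) (G : graph A).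
Variable h : graph_hom Gamma G.

Definition induced (z : fullshift B) : fullshift A := fun j => h (z j).

Definition weakly_left_resolving : Prop := forall b c : B,
  term Gamma b = term Gamma c -> h b = h c -> b = c.

Definition weakly_right_resolving : Prop := forall b c : B,
  init Gamma b = init Gamma c -> h b = h c -> b = c.

Definition left_resolving : Prop := forall (u : vertex Gamma) (a : A),
  term G a = on_vertex h u -> exists! b : B, h b = a /\ term Gamma b = u.

Definition right_resolving : Prop := forall (u : vertex Gamma) (a : A),
  init G a = on_vertex h u -> exists! b : B, h b = a /\ init Gamma b = u.

End Resolving.

Record textile (B A : finType) := Textile {
  textile_dom : graph B;
  textile_cod : graph A;
  tp : graph_hom textile_dom textile_cod;
  tq : graph_hom textile_dom textile_cod
}.

Inductive resolving_term := pL | pR | qL | qR.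

Definition textile_is (P : resolving_term) (B A : finType) (T : textile B A) :
    Prop :=
  match P with
  | pL => left_resolving (tp T)
  | pR => right_resolving (tp T)
  | qL => left_resolving (tq T)
  | qR => right_resolving (tq T)
  end.

Definition textile_weakly (P : resolving_term) (B A : finType)
    (T : textile B A) : Prop :=
  match P with
  | pL => weakly_left_resolving (tp T)
  | pR => weakly_right_resolving (tp T)
  | qL => weakly_left_resolving (tq T)
  | qR => weakly_right_resolving (tq T)
  end.

(* [phi] is [phi_q \o (phi_p|_Z)^-1], the map [phi_p|_Z] being a bijection of
   [Z] onto [X]. *)
Definition presented_by (B A : finType) (T : textile B A)
    (Z : set (fullshift B)) (X : subshift A) (phi : X -> X) : Prop :=
  [/\ set_inj Z (induced (tp T)),
      induced (tp T) @` Z = X,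
      induced (tq T) @` Z `<=` X
    & forall (z : fullshift B) (x : X), Z z ->
        induced (tp T) z = \val x -> \val (phi x) = induced (tq T) z].

(* The arc-set of the codomain of [T] is the alphabet of [X]. This loses nothing:
   weak resolvingness survives deleting from the codomain the arcs that do not
   occur in [X], with the arcs above them, and adding isolated arcs to it. *)
Definition weakly (P : resolving_term) (A : finType) (X : subshift A)
    (phi : X -> X) : Prop :=
  exists (B : finType) (T : textile B A) (Z : subshift B),
    [/\ textile_weakly P T, Z `<=` paths (textile_dom T)
      & presented_by T Z phi].

Definition Z_T (B A : finType) (T : textile B A) : set (fullshift B) :=
  [set z | exists zs : int -> fullshift B,
    [/\ forall i, paths (textile_dom T) (zs i),
        zs 0 = z
      & forall i, induced (tq T) (zs (i - 1)) = induced (tp T) (zs i)]].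

Definition resolving (P : resolving_term) (A : finType) (G : graph A)
    (phi : path_shift G -> path_shift G) : Prop :=
  exists (B : finType) (Gamma : graph B) (p q : graph_hom Gamma G),
    textile_is P (Textile p q) /\
    presented_by (Textile p q) (Z_T (Textile p q)) phi.

Definition essentially_weakly (P : resolving_term) (A : finType)
    (X : subshift A) (phi : X -> X) : Prop :=
  exists (A' : finType) (X' : subshift A') (phi' : X' -> X') (theta : X -> X'),
    [/\ (1 < #|A'|)%N, endomorphism phi', weakly P phi', conjugacy theta
      & forall x, theta (phi x) = phi' (theta x)].

Definition essentially (P : resolving_term) (A : finType) (X : subshift A)
    (phi : X -> X) : Prop :=
  exists (A' : finType) (G : graph A') (phi' : path_shift G -> path_shift G)
    (theta : X -> path_shift G),
    [/\ nondegenerate G, endomorphism phi' /\ onto phi', resolving P phi',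
        conjugacy theta & forall x, theta (phi x) = phi' (theta x)].

Definition compatible_metric (R : realType) (T : topologicalType)
    (d : T -> T -> R) : Prop :=
  [/\ forall x y, d x y = 0 <-> x = y,
      forall x y, d x y = d y x,
      forall x y z, d x z <= d x y + d y z
    & forall (x : T) (U : set T),
        nbhs x U <-> exists2 e : R, 0 < e & [set y | d x y < e] `<=` U].

Section Expansive.
Variables (R : realType) (A : finType) (X : subshift A).
Variables (d : X -> X -> R) (phi : X -> X).

Definition is_orbit (x : int -> X) : Prop := forall i, phi (x i) = x (i + 1).

Definition left_expansive : Prop :=
  exists2 delta : R, 0 < delta &
    forall x y : int -> X, is_orbit x -> is_orbit y ->
      (forall i j : int, j <= 0 ->
        d (sigma j (x i)) (sigma j (y i)) <= delta) ->
      x = y.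

Definition right_expansive : Prop :=
  exists2 delta : R, 0 < delta &
    forall x y : int -> X, is_orbit x -> is_orbit y ->
      (forall i j : int, 0 <= j ->
        d (sigma j (x i)) (sigma j (y i)) <= delta) ->
      x = y.

Definition positively_left_expansive : Prop :=
  exists2 delta : R, 0 < delta &
    forall x y : X,
      (forall (i : nat) (j : int), j <= 0 ->
        d (sigma j (iter i phi x)) (sigma j (iter i phi y)) <= delta) ->
      x = y.

Definition positively_right_expansive : Prop :=
  exists2 delta : R, 0 < delta &
    forall x y : X,
      (forall (i : nat) (j : int), 0 <= j ->
        d (sigma j (iter i phi x)) (sigma j (iter i phi y)) <= delta) ->
      x = y.

End Expansive.

Definition power_shift (A : finType) (X : subshift A) (phi : X -> X)
    (i : nat) (j : int) : X -> X :=
  fun x => iter i phi (sigma j x).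

(* Main.v *)
Require Import Defs.
From mathcomp Require Import all_boot all_order all_algebra.
From mathcomp Require Import all_classical all_reals.
From mathcomp Require Import ereal topology normedtype sequences.
From mathcomp Require Import zify lra.

(* Write [x] on [[c, oo)] for the restriction of [x]; up to reflection only
   half-lines going right matter. [P_L(phi)] is the largest [c] such that [x] on
   [[0, oo)] determines [phi x] on [[-c, oo)], and [Q_L(phi)] is the largest [c]
   such that, for right-asymptotic [x] and [y], [phi x = phi y] on [[c, oo)]
   implies [x = y] on [[0, oo)]. Both are superadditive, so by Fekete's lemma
   [p_L > r] (resp. [q_L > r]) iff some power [phi^s] has degree [> r s], and the
   claims on [phi^i sigma^j] reduce to those on [phi].

   A weakly p-L (q-L) presentation gives degree [>= 0]: the points of [Z] agree
   far to the right, and weak resolvingness propagates this to the left.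
   Conversely, degree [>= 0] makes the words of [(x, phi x)] a weakly resolving
   presentation, and if [phi^s] has degree [>= 0] then [phi] acquires it on the
   conjugate subshift of the sequences [(x, phi x, ..., phi^(s-1) x)]. Limits of
   orbits along a free ultrafilter show that degree [>= 0] and expansiveness give
   a power of degree [>= 1], which in turn gives expansiveness.

   For a subshift of finite type the same words form a block graph over which
   [Z_T] consists of all paths, [phi] being onto. The presentation is resolving
   because points can be glued: directly for [p], by pulling back through [phi]
   for [q] when [phi] is injective. When the shift is transitive, take a word of
   the image over which the number of end blocks is minimal: each of these blocks
   lifts all continuations, this property is inherited by the following blocks,
   and by transitivity every block has it. *)

Set Implicit Arguments.
Unset Strict Implicit.
Unset Printing Implicit Defensive.

Import Order.TTheory GRing.Theory Num.Theory.
Local Open Scope classical_set_scope.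
Local Open Scope ring_scope.

(** * Topology of subshifts through central windows *)

Definition agree_upto (A : finType) (r : nat) (a b : fullshift A) : Prop :=
  forall j : int, `|j| <= r%:Z -> a j = b j.

Lemma nbhs_coord (A : finType) (a : fullshift A) (k : int) :
  nbhs a [set b : fullshift A | b k = a k].
Proof.
have : {for a, continuous (fun b : fullshift A => b k)}.
  exact: (@proj_continuous int (fun=> discrete_topology A) k a).
move=> /(_ [set a k]) /=; apply.
exact: (@discrete_set1 (discrete_topology A)).
Qed.

Lemma nbhs_fullshiftP (A : finType) (a : fullshift A) (U : set (fullshift A)) :
  nbhs a U <-> exists r, forall b, agree_upto r b a -> U b.
Proof.
split=> [nU|[r rU]]; last first.
  apply: (@filterS _ _ _ [set b | agree_upto r b a]) => [b|]; first exact: rU.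
  elim: r {rU} => [|r IH].
    apply: filterS (nbhs_coord a 0) => b b0 j j0.
    by have -> : j = 0 by lia.
  apply: filterS (filterI IH (filterI (nbhs_coord a r.+1%:Z)
    (nbhs_coord a (- r.+1%:Z)))) => b [/= br [b1 b2]] j jr.
  have [-> //|j1] := eqVneq j r.+1%:Z.
  have [-> //|j2] := eqVneq j (- r.+1%:Z).
  by apply: br; lia.
pose F := filter_from [set: nat] (fun r => [set b | agree_upto r b a]).
have FF : Filter F.
  apply: filter_from_filter; first by exists 0%N.
  move=> r s _ _; exists (r + s)%N => // b rs; split=> j jr; apply: rs; lia.
(* The topology is the supremum of those induced by the coordinates, so convergence of the window
   filter is checked one coordinate at a time. *)
have : F --> (a : fullshift A).
  apply/cvg_sup => k V [W] [[O] oO <-] OaN OV.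
  apply: (@filterS _ _ _ [set b | b k = a k]).
    by move=> b bk; apply: OV => /=; rewrite bk.
  by exists `|k|%N => // b; apply; lia.
by move=> /(_ _ nU) [r _ rU]; exists r => b br; apply: rU.
Qed.

Section Subshift.
Variables (A : finType) (X : subshift A).
Implicit Types (x y : X) (U : set X).

Lemma eq_point x y : (forall j, \val x j = \val y j) -> x = y.
Proof. by move=> xy; apply/val_inj/funext. Qed.

Lemma val_sigma k x j : \val (sigma k x) j = \val x (j + k).
Proof. by []. Qed.

Lemma sigmaD k l x : sigma k (sigma l x) = sigma (k + l) x.
Proof. by apply: eq_point => j; rewrite !val_sigma addrA. Qed.

Lemma sigma0 x : sigma 0 x = x.
Proof. by apply: eq_point => j; rewrite !val_sigma addr0. Qed.

Lemma sigmaK k x : sigma (- k) (sigma k x) = x.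
Proof. by rewrite sigmaD addNr sigma0. Qed.

Lemma sigmaVK k x : sigma k (sigma (- k) x) = x.
Proof. by rewrite sigmaD subrr sigma0. Qed.

Definition point (a : fullshift A) (Xa : points X a) : X := SigSub (mem_set Xa).

Lemma pointP x : points X (\val x).
Proof. exact: set_mem (valP x). Qed.

Lemma nbhs_subshiftP x U :
  nbhs x U <-> exists r, forall y, agree_upto r (\val y) (\val x) -> U y.
Proof.
split=> [[V] [[O] oO <-] /= Ox OU|[r rU]].
  have /nbhs_fullshiftP[r rO] : nbhs (\val x) O by apply: open_nbhs_nbhs.
  by exists r => y /rO; apply: OU.
have : nbhs (\val x) [set b | agree_upto r b (\val x)].
  by apply/nbhs_fullshiftP; exists r.
rewrite nbhsE => -[O [oO Ox] OU].
exists (\val @^-1` O); split; first by exists O.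
  exact: Ox.
by move=> y /OU; apply: rU.
Qed.

End Subshift.

Lemma subshift_continuousP (A B : finType) (X : subshift A) (Y : subshift B)
    (f : X -> Y) :
  continuous f <-> forall x j, exists r, forall y,
    agree_upto r (\val y) (\val x) -> \val (f y) j = \val (f x) j.
Proof.
split=> [fc x j|fr x U].
  have : nbhs (f x) [set y | \val y j = \val (f x) j].
    by apply/nbhs_subshiftP; exists `|j|%N => y; apply; lia.
  by move=> /fc /nbhs_subshiftP.
move=> /nbhs_subshiftP[r rU]; apply/nbhs_subshiftP.
(* One window serves all coordinates up to [r]: the radii found for each of them are added. *)
have [s sr] : exists s, forall y, agree_upto s (\val y) (\val x) ->
    agree_upto r (\val (f y)) (\val (f x)).
  elim: r {rU} => [|r [s sr]].
    have [s sr] := fr x 0; exists s => y /sr xy j j0.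
    by have -> : j = 0 by lia.
  have [s1 sr1] := fr x r.+1%:Z; have [s2 sr2] := fr x (- r.+1%:Z).
  exists (s + s1 + s2)%N => y xy j jr.
  have [->|j1] := eqVneq j r.+1%:Z; first by apply: sr1 => k kr; apply: xy; lia.
  have [->|j2] := eqVneq j (- r.+1%:Z).
    by apply: sr2 => k kr; apply: xy; lia.
  by apply: sr => [k kr|]; [apply: xy; lia|lia].
by exists s => y /sr /rU.
Qed.

(** * Compactness by ultrafilter limits *)

Lemma free_ultrafilter : {U : set_system nat | UltraFilter U /\ \oo `<=` U}.
Proof. by apply: cid; apply: ultraFilterLemma. Qed.

(** Limits along one fixed free ultrafilter exist for every sequence and commute with continuous
    maps, so no subsequences have to be extracted. *)
Definition ultra : set_system nat := projT1 free_ultrafilter.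

#[global] Instance ultra_ultra : UltraFilter ultra.
Proof. exact: (projT2 free_ultrafilter).1. Qed.

Lemma ultra_ge N : ultra [set n | (N <= n)%N].
Proof. by apply: (projT2 free_ultrafilter).2; exists N. Qed.

(** Otherwise the complements of all fibres would lie in the ultrafilter, and so would their finite
    intersection, which is empty. *)
Lemma ultra_finite (B : finType) (f : nat -> B) :
  exists b, ultra [set n | f n = b].
Proof.
apply: contrapT => /forallNP nb.
have ns (s : seq B) : ultra [set n | f n \notin s].
  elim: s => [|b s IH]; first by apply: filterS filterT.
  have fb : ultra [set n | f n <> b].
    by have [/nb|] := in_ultra_setVsetC [set n | f n = b] ultra_ultra.
  apply: filterS (filterI fb IH) => n [/eqP nfb nfs].
  by rewrite /= inE negb_or nfb.
by have /filter_ex[n] := ns (enum B); rewrite /= mem_enum.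
Qed.

Lemma ultra_const (P : Prop) : ultra (fun=> P) -> P.
Proof. by move=> /filter_ex []. Qed.

Section Limit.
Variable A : finType.
Implicit Type u : nat -> fullshift A.

Definition ulim u : fullshift A :=
  fun j => projT1 (cid (ultra_finite (fun n => u n j))).

Lemma ulimE u j : ultra [set n | u n j = ulim u j].
Proof. exact: projT2 (cid (ultra_finite (fun n => u n j))). Qed.

Lemma ulim_upto u r : ultra [set n | agree_upto r (u n) (ulim u)].
Proof.
elim: r => [|r IH].
  apply: filterS (ulimE u 0) => n n0 j j0.
  by have -> : j = 0 by lia.
apply: filterS (filterI IH (filterI (ulimE u r.+1%:Z)
  (ulimE u (- r.+1%:Z)))) => b [/= br [b1 b2]] j jr.
have [-> //|j1] := eqVneq j r.+1%:Z.
have [-> //|j2] := eqVneq j (- r.+1%:Z).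
by apply: br; lia.
Qed.

Lemma ulim_uniq u a : (forall j, ultra [set n | u n j = a j]) -> ulim u = a.
Proof.
move=> ua; apply/funext => j; apply: ultra_const.
by apply: filterS (filterI (ua j) (ulimE u j)) => n [/= <- <-].
Qed.

Lemma ulim_closed (Z : set (fullshift A)) u : closed Z ->
  ultra [set n | Z (u n)] -> Z (ulim u).
Proof.
move=> Zc Zu; apply: Zc => U /nbhs_fullshiftP[r rU].
have [n [Zn /rU Un]] := filter_ex (filterI Zu (ulim_upto u r)).
by exists (u n).
Qed.

(** A point of the closure is the limit of points of [Z] agreeing with it on growing windows. *)
Lemma closed_ulim (Z : set (fullshift A)) :
  (forall u, (forall n, Z (u n)) -> Z (ulim u)) -> closed Z.
Proof.
move=> Zlim a aZ.
have /choice[u uP] n : exists b, Z b /\ agree_upto n b a.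
  have /aZ[b [Zb ba]] : nbhs a [set b | agree_upto n b a].
    by apply/nbhs_fullshiftP; exists n.
  by exists b.
suff <- : ulim u = a by apply: Zlim => n; have [] := uP n.
apply: ulim_uniq => j.
apply: filterS (ultra_ge `|j|%N) => n /= jn.
by have [_] := uP n; apply; lia.
Qed.

End Limit.

Section PointLimit.
Variables (A : finType) (X : subshift A).
Implicit Type u : nat -> X.

Lemma plim_subproof u : points X (ulim (fun n => \val (u n))).
Proof.
apply: ulim_closed; first exact: subshift_closed.
by apply: filterS filterT => n _; apply: pointP.
Qed.

Definition plim u : X := point (plim_subproof u).

Lemma plimE u j : ultra [set n | \val (u n) j = \val (plim u) j].
Proof. exact: ulimE. Qed.

Lemma plim_upto u r : ultra [set n | agree_upto r (\val (u n)) (\val (plim u))].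
Proof. exact: ulim_upto. Qed.

Lemma plim_eq u v : (forall j, ultra [set n | \val (u n) j = \val (v n) j]) ->
  plim u = plim v.
Proof.
move=> uv; apply: val_inj; apply: ulim_uniq => j.
by apply: filterS (filterI (uv j) (plimE v j)) => n [/= -> ->].
Qed.

Lemma plim_eq_at u v j : ultra [set n | \val (u n) j = \val (v n) j] ->
  \val (plim u) j = \val (plim v) j.
Proof.
move=> uv; apply: ultra_const.
by apply: filterS (filterI uv (filterI (plimE u j) (plimE v j))) =>
  n [/= e [<- <-]].
Qed.

Lemma plim_neq_at u v j : ultra [set n | \val (u n) j <> \val (v n) j] ->
  \val (plim u) j <> \val (plim v) j.
Proof.
move=> uv e; apply: ultra_const.
by apply: filterS (filterI uv (filterI (plimE u j) (plimE v j))) =>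
  n [/= ne [eu ev]]; apply: ne; rewrite eu ev.
Qed.

(** If for each [n] some pair satisfied [Q n] but not [T], the limits of these pairs would satisfy
    every [Q k], hence [T], and openness would return [T] to one of the pairs. This reduces
    infinitely many coordinates or times to finitely many. *)
Lemma compactness (Q : nat -> X -> X -> Prop) (T : X -> X -> Prop) :
  (forall k l x y, (k <= l)%N -> Q l x y -> Q k x y) ->
  (forall k u v, ultra [set n | Q k (u n) (v n)] -> Q k (plim u) (plim v)) ->
  (forall u v, T (plim u) (plim v) -> ultra [set n | T (u n) (v n)]) ->
  (forall x y, (forall k, Q k x y) -> T x y) ->
  exists k, forall x y, Q k x y -> T x y.
Proof.
move=> Qmon Qcl Top QT; apply: contrapT => /forallNP nQ.
have /choice[u /choice[v uv]] n : exists x, exists y, Q n x y /\ ~ T x y.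
  have /existsNP[x /existsNP[y /not_implyP xy]] := nQ n.
  by exists x, y.
have /Top : T (plim u) (plim v).
  apply: QT => k; apply: Qcl.
  by apply: filterS (ultra_ge k) => n kn; apply: Qmon kn (uv n).1.
by move=> /filter_ex[n]; have [] := uv n.
Qed.

Lemma eq_at_open u v j : \val (plim u) j = \val (plim v) j ->
  ultra [set n | \val (u n) j = \val (v n) j].
Proof.
move=> uv; apply: filterS (filterI (plimE u j) (plimE v j)) => n [/= -> ->].
exact: uv.
Qed.

End PointLimit.

(** * Continuous equivariant maps as block maps *)

Section Continuous.
Variables (A B : finType) (X : subshift A) (Y : subshift B) (f : X -> Y).
Hypothesis fc : continuous f.

Lemma plim_continuous u : f (plim u) = plim (fun n => f (u n)).
Proof.
apply/esym/val_inj; apply: ulim_uniq => j.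
have /subshift_continuousP/(_ (plim u) j)[r rf] := fc.
by apply: filterS (plim_upto u r) => n /rf.
Qed.

Lemma continuous_window : exists r, forall x y,
  agree_upto r (\val x) (\val y) -> \val (f x) 0 = \val (f y) 0.
Proof.
apply: (@compactness _ _ (fun k x y => agree_upto k (\val x) (\val y))
  (fun x y => \val (f x) 0 = \val (f y) 0)).
- by move=> k l x y kl xy j jk; apply: xy; lia.
- move=> k u v uv j jk; apply: plim_eq_at.
  by apply: filterS uv => n; apply.
- by move=> u v; rewrite !plim_continuous; apply: eq_at_open.
- move=> x y xy; suff -> : x = y by [].
  by apply: eq_point => j; apply: (xy `|j|%N); lia.
Qed.

Hypothesis fs : forall x, f (sigma 1 x) = sigma 1 (f x).

Lemma equivariant k x : f (sigma k x) = sigma k (f x).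
Proof.
have fsN y : f (sigma (-1) y) = sigma (-1) (f y).
  by rewrite -[in RHS](sigmaVK 1 y) fs sigmaK.
elim/int_rec: k x => [|n IH|n IH] x; first by rewrite !sigma0.
  by rewrite -addn1 PoszD -sigmaD IH fs sigmaD.
by rewrite -addn1 PoszD opprD -sigmaD IH fsN sigmaD.
Qed.

(** The Curtis-Hedlund-Lyndon theorem: compactness gives a window for the coordinate 0, and the
    shift carries it to all others. *)
Lemma block_map : exists r : nat, forall x y i,
  (forall j, i - r%:Z <= j <= i + r%:Z -> \val x j = \val y j) ->
  \val (f x) i = \val (f y) i.
Proof.
have [r rf] := continuous_window; exists r => x y i xy.
rewrite -[i]add0r -!val_sigma -!equivariant; apply: rf => j jr.
by rewrite !val_sigma; apply: xy; lia.
Qed.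

End Continuous.

Lemma continuous_block (A B : finType) (X : subshift A) (Y : subshift B)
    (f : X -> Y) :
  (forall x, f (sigma 1 x) = sigma 1 (f x)) ->
  (exists r, forall x y, agree_upto r (\val x) (\val y) ->
    \val (f x) 0 = \val (f y) 0) ->
  continuous f.
Proof.
move=> fs [r rf]; apply/subshift_continuousP => x j.
exists (r + `|j|)%N => y xy.
rewrite -[j]add0r -!val_sigma -!(equivariant fs); apply: rf => k kr.
by rewrite !val_sigma; apply: xy; lia.
Qed.

(** By injectivity all of [f x] determines the coordinate 0 of [x]; by compactness a finite window
    of [f x] does, so the inverse is continuous too. *)
Lemma bijective_conjugacy (A B : finType) (X : subshift A) (Y : subshift B)
    (f : X -> Y) :
  continuous f -> (forall x, f (sigma 1 x) = sigma 1 (f x)) ->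
  injective f -> onto f -> conjugacy f.
Proof.
move=> fc fs finj /choice[g gK]; split=> //; split=> //.
have fK : cancel f g by move=> x; apply: finj; rewrite gK.
exists g; split=> //; apply: continuous_block.
  by move=> y; apply: finj; rewrite fs !gK.
suff [r rf] : exists r, forall x y, agree_upto r (\val (f x)) (\val (f y)) ->
    \val x 0 = \val y 0.
  by exists r => x y xy; apply: rf; rewrite !gK.
apply: (@compactness _ _ (fun k x y => agree_upto k (\val (f x)) (\val (f y)))
  (fun x y => \val x 0 = \val y 0)).
- by move=> k l x y kl xy j jk; apply: xy; lia.
- move=> k u v uv j jk; rewrite !(plim_continuous fc); apply: plim_eq_at.
  by apply: filterS uv => n; apply.
- by move=> u v; apply: eq_at_open.
- move=> x y xy; suff -> : x = y by [].
  by apply: finj; apply: eq_point => j; apply: (xy `|j|%N); lia.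
Qed.

(** * One-sided determination and expansiveness *)

Lemma endomorphism_iter (A : finType) (X : subshift A) (phi : X -> X) s :
  endomorphism phi -> endomorphism (iter s phi).
Proof.
move=> [phic phis]; split; elim: s => [|s IH] x //=; last by rewrite IH phis.
by apply: (@continuous_comp _ _ _ (iter s phi) phi); [exact: IH|exact: phic].
Qed.

Lemma conjugacy_sym (A B : finType) (X : subshift A) (Y : subshift B)
    (theta : X -> Y) : conjugacy theta ->
  exists2 g : Y -> X, conjugacy g & cancel theta g /\ cancel g theta.
Proof.
move=> [[tc [g [gc tK gK]]] ts]; exists g => //; split; last first.
  by move=> y; rewrite -[in LHS](gK y) -ts tK.
by split=> //; exists theta.
Qed.

Lemma conjugacy_comp (A B C : finType) (X : subshift A) (Y : subshift B)
    (Z : subshift C) (f : X -> Y) (g : Y -> Z) :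
  conjugacy f -> conjugacy g -> conjugacy (g \o f).
Proof.
move=> [[fc [f' [f'c fK f'K]]] fs] [[gc [g' [g'c gK g'K]]] gs].
split; last by move=> x /=; rewrite fs gs.
split; first by move=> x; apply: continuous_comp; [exact: fc|exact: gc].
exists (f' \o g'); split; [|exact: can_comp|exact: can_comp].
by move=> x; apply: continuous_comp; [exact: g'c|exact: f'c].
Qed.

Lemma iter_conj (S T : Type) (f : S -> S) (g : T -> T) (h : S -> T) n x :
  (forall x, h (f x) = g (h x)) -> h (iter n f x) = iter n g (h x).
Proof. by move=> hf; elim: n => //= n <-. Qed.

Lemma sideP (e : int) : e * e = 1 -> e = 1 \/ e = - 1.
Proof.
move=> ee; have : (e - 1) * (e + 1) = 0 by rewrite mulrDr mulrBl ee; lia.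
by move/eqP; rewrite mulf_eq0 => /orP[] /eqP; lia.
Qed.

(* The side [e] is [1] for the half-lines going right and [-1] for those going
   left. *)
Definition agree_from (A : finType) (X : subshift A) (e c : int) (x y : X) :
    Prop :=
  forall j : int, c <= j -> \val x (e * j) = \val y (e * j).

Section Side.
Variable (e : int).
Section Agree.
Variables (A : finType) (X : subshift A).
Implicit Types (x y : X) (phi : X -> X) (c k : int).

Lemma agree_from_sigma c k x y :
  agree_from e c (sigma (e * k) x) (sigma (e * k) y) <->
  agree_from e (c + k) x y.
Proof.
split=> xy j cj.
  have := xy (j - k); rewrite !val_sigma -mulrDr subrK; apply; lia.
by rewrite !val_sigma -mulrDr; apply: xy; lia.
Qed.

Lemma agree_from_le c k x y :
  c <= k -> agree_from e c x y -> agree_from e k x y.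
Proof. by move=> ck xy j kj; apply: xy; lia. Qed.

Lemma agree_from_pred c x y : agree_from e c x y ->
  \val x (e * (c - 1)) = \val y (e * (c - 1)) -> agree_from e (c - 1) x y.
Proof.
move=> xy xy1 j cj; have [-> //|jc] := eqVneq j (c - 1); apply: xy; lia.
Qed.

End Agree.

Section DegreeDef.
Variables (A : finType) (X : subshift A).
Implicit Types (x y : X) (phi psi : X -> X) (c k : int).

(* [P_L] and [P_R] are the suprema of the [c] such that [determines e phi c],
   for [e = 1] and [e = -1], and [Q_L] and [Q_R] are those of the [c] such that
   [recovers e phi c]. *)
Definition determines phi c : Prop := forall x y,
  agree_from e 0 x y -> agree_from e (- c) (phi x) (phi y).

Definition recovers phi c : Prop := forall x y a,
  agree_from e a x y -> agree_from e c (phi x) (phi y) -> agree_from e 0 x y.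

(** Metric-free form of expansiveness: closeness on a half-line is replaced by agreement on it. *)
Definition expansive phi : Prop := forall x y : int -> X,
  is_orbit phi x -> is_orbit phi y ->
  (forall i, agree_from e 0 (x i) (y i)) -> x = y.

Definition positively_expansive phi : Prop := forall x y,
  (forall i, agree_from e 0 (iter i phi x) (iter i phi y)) -> x = y.

(** By superadditivity this amounts to a positive limit of the degrees of [phi^s] divided by [s]. *)
Definition eventually_determines phi : Prop :=
  exists2 s, (0 < s)%N & determines (iter s phi) 1.

Definition eventually_recovers phi : Prop :=
  exists2 s, (0 < s)%N & recovers (iter s phi) 1.

Lemma determines_le phi c k : c <= k -> determines phi k -> determines phi c.
Proof. by move=> ck D x y /D; apply: agree_from_le; lia. Qed.

Lemma recovers_le phi c k : c <= k -> recovers phi k -> recovers phi c.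
Proof.
by move=> ck E x y a xy fxy; apply: E xy _; apply: agree_from_le fxy.
Qed.

End DegreeDef.

Hypothesis ee : e * e = 1.

Lemma mulee j : e * (e * j) = j.
Proof. by rewrite mulrA ee mul1r. Qed.

Lemma agree_from_eq (A : finType) (X : subshift A) (x y : X) :
  (forall k : nat, agree_from e (- k%:Z) x y) -> x = y.
Proof.
move=> xy; apply: eq_point => j; rewrite -(mulee j).
by apply: (xy (absz (e * j)) (e * j)); lia.
Qed.

Section BlockMap.
Variables (A B : finType) (X : subshift A) (Y : subshift B) (f : X -> Y).
Hypothesis fc : continuous f.
Hypothesis fs : forall x, f (sigma 1 x) = sigma 1 (f x).

Lemma agree_from_map : exists r : nat, forall c x y,
  agree_from e c x y -> agree_from e (c + r%:Z) (f x) (f y).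
Proof.
have [r rf] := block_map fc fs; exists r => c x y xy j cj.
apply: rf => k; rewrite -(mulee k) => kj; apply: xy.
by move: kj; rewrite (mulee k); case: (sideP ee) => ->; lia.
Qed.

End BlockMap.

Section Degree.
Variables (A : finType) (X : subshift A).
Implicit Types (x y : X) (phi psi : X -> X) (c k : int).

Lemma determines_sigma phi c k x y : endomorphism phi -> determines phi c ->
  agree_from e k x y -> agree_from e (k - c) (phi x) (phi y).
Proof.
move=> [phic phis] D; rewrite -[k]add0r => /agree_from_sigma /D.
rewrite !(equivariant phis) => /agree_from_sigma.
by apply: agree_from_le; lia.
Qed.

Lemma recovers_sigma phi c k a x y : endomorphism phi -> recovers phi c ->
  agree_from e a x y -> agree_from e (c + k) (phi x) (phi y) ->
  agree_from e k x y.
Proof.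
move=> [phic phis] E xy /agree_from_sigma.
rewrite -!(equivariant phis) => fxy; rewrite -[k]add0r.
apply/agree_from_sigma; apply: (E _ _ (a - k)) fxy.
by apply/agree_from_sigma; rewrite subrK.
Qed.

Lemma determines_bound phi : endomorphism phi -> exists c, determines phi c.
Proof.
move=> [phic phis]; have [r rf] := agree_from_map phic phis.
by exists (- r%:Z) => x y /rf; rewrite opprK add0r.
Qed.

Lemma determines_iterD phi s t c k : endomorphism phi ->
  determines (iter s phi) c -> determines (iter t phi) k ->
  determines (iter (s + t) phi) (c + k).
Proof.
move=> ephi Ds Dt x y /Dt xy; rewrite !iterD.
have := determines_sigma (endomorphism_iter s ephi) Ds xy.
by apply: agree_from_le; lia.
Qed.

(** First the images under [iter t phi] are recovered, then the points. The first recovery needs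
    these images to be asymptotic, which holds since [iter t phi] is a block map. *)
Lemma recovers_iterD phi s t c k : endomorphism phi ->
  recovers (iter s phi) c -> recovers (iter t phi) k ->
  recovers (iter (s + t) phi) (c + k).
Proof.
move=> ephi Es Et x y a xy; rewrite !iterD => fxy; apply: (Et _ _ _ xy).
have [tc ts] := endomorphism_iter t ephi.
have [r rf] := agree_from_map tc ts.
exact: recovers_sigma (endomorphism_iter s ephi) Es (rf _ _ _ xy) fxy.
Qed.

Lemma determines_iter0 phi : determines (iter 0 phi) 0.
Proof. by []. Qed.

Lemma recovers_iter0 phi : recovers (iter 0 phi) 0.
Proof. by []. Qed.

(** The other iterations move the boundary of agreement by at most [r], so [phi] inherits a bound
    from its power. Fekete's lemma needs this as [Sinv]. *)
Lemma recovers_iter_inv phi s c : endomorphism phi -> (0 < s)%N ->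
  recovers (iter s phi) c -> exists k, recovers phi k.
Proof.
case: s => // s ephi _ E.
have [sc ss] := endomorphism_iter s ephi.
have [r rf] := agree_from_map sc ss.
exists (c - r%:Z) => x y a xy fxy; apply: E xy _; rewrite !iterSr.
by move/rf: fxy; rewrite subrK.
Qed.

(** Each time of an orbit comes [s] steps after another one, so agreement from [- k] at all times
    improves to agreement from [- k - 1] at all times. *)
Lemma eventually_determines_expansive phi : endomorphism phi ->
  eventually_determines phi -> expansive phi.
Proof.
move=> ephi [s s0 D] x y xo yo xy.
have orbit z i n : is_orbit phi z -> z (i + n%:Z) = iter n phi (z i).
  move=> zo; elim: n => [|n IH]; first by rewrite addr0.
  by rewrite iterS -IH zo -addrA -PoszD addn1.
suff xyk (k : nat) i : agree_from e (- k%:Z) (x i) (y i).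
  by apply/funext => i; apply: agree_from_eq => k.
elim: k i => [|k IH] i; first by rewrite oppr0.
rewrite -[i](subrK s%:Z) !orbit //.
have := determines_sigma (endomorphism_iter s ephi) D (IH (i - s%:Z)).
by apply: agree_from_le; lia.
Qed.

(** Forward orbits recentred at time [n] have more and more past, and their limit is an orbit over
    all integer times. The truncation by [absz] matters only for the finitely many [n] with [n + m]
    negative. *)
Lemma limit_orbit phi (w : nat -> X) : endomorphism phi ->
  is_orbit phi (fun m => plim (fun n => iter (absz (n%:Z + m)) phi (w n))).
Proof.
move=> [phic _] m; rewrite (plim_continuous phic); apply: plim_eq => j.
apply: filterS (ultra_ge `|m|%N) => n /= mn.
by rewrite -iterS (_ : (absz (n%:Z + m)).+1 = absz (n%:Z + (m + 1))) //; lia.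
Qed.

(* If no power gains a coordinate, then orbits that agree on the half-line and
   disagree next to it arise as limits of segments centred at longer and longer
   times. *)
Lemma determines_expansive phi : endomorphism phi -> determines phi 0 ->
  expansive phi -> eventually_determines phi.
Proof.
move=> ephi D0 ex; apply: contrapT => nD.
have D0n n : determines (iter n phi) 0.
  elim: n => [|n IH] //; rewrite -addn1 -[0]addr0.
  exact: determines_iterD.
have /choice[u /choice[v uv]] n : exists x, exists y,
    agree_from e 0 x y /\ ~ agree_from e (- 1) (iter n phi x) (iter n phi y).
  (* The exponent [n.+1] is positive, as [eventually_determines] asks; one iteration is then
     absorbed into the points. *)
  have : ~ determines (iter n.+1 phi) 1 by move=> D; apply: nD; exists n.+1.
  move=> /existsNP[x /existsNP[y /not_implyP[xy nxy]]].
  exists (phi x), (phi y); rewrite -!iterSr; split=> //.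
  by have := D0 _ _ xy; rewrite oppr0.
have uv0 n m : agree_from e 0 (iter m phi (u n)) (iter m phi (v n)).
  by have := D0n m _ _ (uv n).1; rewrite oppr0.
pose x m := plim (fun n => iter (absz (n%:Z + m)) phi (u n)).
pose y m := plim (fun n => iter (absz (n%:Z + m)) phi (v n)).
have xy : x = y.
  apply: ex; [exact: limit_orbit|exact: limit_orbit|] => m j j0.
  by apply: plim_eq_at; apply: filterS filterT => n _; apply: uv0.
have : \val (x 0) (e * - 1) <> \val (y 0) (e * - 1).
  apply: plim_neq_at; apply: filterS filterT => n _ /=.
  rewrite addn0.
  move=> uv1; apply: (uv n).2.
  by rewrite -[- 1]add0r; apply: agree_from_pred => //; rewrite add0r.
by rewrite xy.
Qed.

(** By induction on [k], the points agree from [- k] at all times. A disagreement at the next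
    coordinate at time [i] persists at all later times, because degree 0 carries agreement
    backwards; recentred limits would then be distinct orbits agreeing on the half-line. *)
Lemma recovers_expansive phi : endomorphism phi -> recovers phi 0 ->
  expansive phi -> positively_expansive phi.
Proof.
move=> ephi E0 ex x y xy; apply: agree_from_eq => k.
suff: forall i, agree_from e (- k%:Z) (iter i phi x) (iter i phi y) by move/(_ 0%N).
elim: k => [|k IH]; first by rewrite oppr0.
apply: contrapT => /existsNP[i nxy].
have back n : agree_from e (- k.+1%:Z) (iter (n + i) phi x) (iter (n + i) phi y) ->
    agree_from e (- k.+1%:Z) (iter i phi x) (iter i phi y).
  elim: n => [//|n IHn]; rewrite addSn !iterS => xyn; apply: IHn.
  by apply: (recovers_sigma ephi E0 (xy _)); rewrite add0r.
pose u m := plim (fun n => iter (absz (n%:Z + m)) phi x).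
pose v m := plim (fun n => iter (absz (n%:Z + m)) phi y).
have uv : u = v.
  apply: ex; [exact: limit_orbit|exact: limit_orbit|] => m j j0.
  by apply: plim_eq_at; apply: filterS filterT => n _; apply: xy.
have : \val (u 0) (e * (- k%:Z - 1)) <> \val (v 0) (e * (- k%:Z - 1)).
  apply: plim_neq_at; apply: filterS (ultra_ge i) => n /= ni.
  rewrite addn0 -(subnK ni).
  move=> uv1; apply: nxy; apply: (back (n - i)%N).
  have -> : - k.+1%:Z = - k%:Z - 1 by lia.
  exact: agree_from_pred.
by rewrite uv.
Qed.

Lemma positively_expansive_expansive phi :
  positively_expansive phi -> expansive phi.
Proof.
move=> pe x y xo yo xy; apply/funext => i; apply: pe => n.
have orbit z m : is_orbit phi z -> z (i + m%:Z) = iter m phi (z i).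
  move=> zo; elim: m => [|m IH]; first by rewrite addr0.
  by rewrite iterS -IH zo -addrA -PoszD addn1.
by rewrite -!orbit.
Qed.

(** Agreement from [- k] at time [s + i] yields agreement from [- k - 1] at time [i], so the bound
    improves at all times at once. *)
Lemma eventually_recovers_positively_expansive phi : endomorphism phi ->
  eventually_recovers phi -> positively_expansive phi.
Proof.
move=> ephi [s s0 E] x y xy; apply: agree_from_eq => k.
suff: forall i, agree_from e (- k%:Z) (iter i phi x) (iter i phi y) by move/(_ 0%N).
elim: k => [|k IH] i; first by rewrite oppr0.
apply: (recovers_sigma (endomorphism_iter s ephi) E (IH i)).
by rewrite -!iterD; apply: agree_from_le (IH _); lia.
Qed.

(** Compactness replaces the infinitely many times of positive expansiveness by the times up to [S],
    at the price of recovering a single coordinate. *)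
Lemma positively_expansive_window phi : endomorphism phi ->
  positively_expansive phi -> exists S : nat, forall c x y,
    (forall i, (i <= S)%N -> agree_from e c (iter i phi x) (iter i phi y)) ->
    agree_from e (c - 1) x y.
Proof.
move=> ephi pe.
have [S ST] : exists S : nat, forall x y,
    (forall i, (i <= S)%N -> agree_from e 0 (iter i phi x) (iter i phi y)) ->
    \val x (e * (0 - 1)) = \val y (e * (0 - 1)).
  apply: (@compactness _ _ (fun S x y => forall i, (i <= S)%N ->
    agree_from e 0 (iter i phi x) (iter i phi y))
    (fun x y => \val x (e * (0 - 1)) = \val y (e * (0 - 1)))).
  - by move=> k l x y kl xy i ik; apply: xy; lia.
  - move=> k u v uv i ik j j0.
    have [ic _] := endomorphism_iter i ephi.
    rewrite !(plim_continuous ic); apply: plim_eq_at.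
    by apply: filterS uv => n /(_ i ik j j0).
  - by move=> u v; apply: eq_at_open.
  - move=> x y xy; suff -> : x = y by [].
    by apply: pe => i; apply: (xy i).
exists S => c x y xy; rewrite addrC; apply/agree_from_sigma.
rewrite -[- 1]add0r; apply: agree_from_pred.
  by apply/agree_from_sigma; rewrite add0r; apply: (xy 0%N).
apply: ST => i iS; have [_ ips] := endomorphism_iter i ephi.
rewrite !(equivariant ips); apply/agree_from_sigma; rewrite add0r.
exact: xy.
Qed.

(* With [S] as in [positively_expansive_window], every [S] steps backwards in
   time gain one coordinate; going back far enough makes up for the coordinates
   lost in the [S] steps after time [s]. *)
Lemma positively_expansive_eventually_recovers phi : endomorphism phi ->
  positively_expansive phi -> eventually_recovers phi.
Proof.
move=> ephi pe; have [S Sgain] := positively_expansive_window ephi pe.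
have [phic phis] := ephi; have [r rf] := agree_from_map phic phis.
(* Agreement from 1 at time [s] spreads to agreement from [M] at the times up to [s + S], and [M]
   gains of [S] steps each fit below [s]. The summand 1 keeps [s] positive. *)
pose M := (1 + r * S)%N; pose s := (M * S + 1)%N.
exists s; first by rewrite /s addn1.
move=> x y a xya xys.
pose ag c t := agree_from e c (iter t phi x) (iter t phi y).
have forward c t n : ag c t -> ag (c + (r * n)%N%:Z) (n + t)%N.
  move=> ct; elim: n => [|n IH]; first by rewrite muln0 addr0.
  by have := rf _ _ _ IH; apply: agree_from_le; lia.
have last t : (s < t)%N -> (t <= s + S)%N -> ag M%:Z t.
  move=> st tS; have := forward _ _ (t - s)%N xys; rewrite subnK ?(ltnW st) //.
  apply: agree_from_le; rewrite /M.
  have : (r * (t - s) <= r * S)%N by rewrite leq_mul2l; apply/orP; right; lia.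
  by lia.
(* Times up to [s] gain one coordinate per round, later ones are bounded by [M] already, so any
   common bound comes down to [M]. *)
have descend n t : (t <= s + S)%N ->
    (forall t, (t <= s + S)%N -> ag (M + n)%N%:Z t) -> ag M%:Z t.
  elim: n t => [|n IH] t tS agn; first by have := agn t tS; rewrite addn0.
  apply: IH => // t1 t1S; have [st1|t1s] := ltnP s t1.
    by apply: agree_from_le (last _ st1 t1S); lia.
  have := Sgain (M + n.+1)%N%:Z (iter t1 phi x) (iter t1 phi y).
  have -> : (M + n.+1)%N%:Z - 1 = (M + n)%N%:Z by lia.
  by apply=> i iS; rewrite -!iterD; apply: agn; lia.
have all_M t : (t <= s + S)%N -> ag M%:Z t.
  move=> tS; apply: (descend (`|a| + r * (s + S))%N) => // t1 t1S.
  have := forward a 0%N t1 xya; rewrite addn0; apply: agree_from_le.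
  have : (r * t1 <= r * (s + S))%N by rewrite leq_mul2l t1S orbT.
  by lia.
have gain (k : nat) t : (t + k * S <= s + S)%N -> ag (M%:Z - k%:Z) t.
  elim: k t => [|k IH] t tk; first by rewrite subr0; apply: all_M; lia.
  have -> : M%:Z - k.+1%:Z = M%:Z - k%:Z - 1 by lia.
  by apply: Sgain => i iS; rewrite -!iterD; apply: IH; lia.
by have := gain M 0%N; rewrite subrr; apply; rewrite /s; lia.
Qed.

End Degree.

Section Conjugate.
Variables (A B : finType) (X : subshift A) (Y : subshift B) (theta : X -> Y).
Variables (phi : X -> X) (psi : Y -> Y).
Hypothesis ephi : endomorphism phi.
Hypothesis epsi : endomorphism psi.
Hypothesis thetac : conjugacy theta.
Hypothesis phi_psi : forall x, theta (phi x) = psi (theta x).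

(** Passing to [Y] costs [r] coordinates of agreement; shifting both points by [e * r] compensates
    this at all times. *)
Lemma positively_expansive_conj :
  positively_expansive psi -> positively_expansive phi.
Proof.
move=> pe x y xy; have [[tc [g [_ tK _]]] ts] := thetac.
have [r rt] := agree_from_map tc ts; apply: (can_inj tK).
suff: sigma (e * r%:Z) (theta x) = sigma (e * r%:Z) (theta y).
  by move=> /(congr1 (sigma (- (e * r%:Z)))); rewrite !sigmaK.
apply: pe => i; have [_ ips] := endomorphism_iter i epsi.
rewrite !(equivariant ips) -!(iter_conj _ _ phi_psi).
by apply/agree_from_sigma; exact: rt (xy i).
Qed.

Lemma expansive_conj : expansive phi -> expansive psi.
Proof.
move=> ex x y xo yo xy; have [g [[gc _] gs] [tK gK]] := conjugacy_sym thetac.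
have [r rg] := agree_from_map gc gs.
have psi_phi z : g (psi z) = phi (g z) by rewrite -{1}(gK z) -phi_psi tK.
have orbit z : is_orbit psi z ->
    is_orbit phi (fun i => sigma (e * r%:Z) (g (z i))).
  by move=> zo i; rewrite (equivariant ephi.2) -psi_phi zo.
have gxy : (fun i => sigma (e * r%:Z) (g (x i))) =
           (fun i => sigma (e * r%:Z) (g (y i))).
  apply: ex; [exact: orbit|exact: orbit|] => i.
  by apply/agree_from_sigma; exact: rg (xy i).
apply/funext => i; apply: (can_inj gK).
by move/(congr1 (fun z => sigma (- (e * r%:Z)) (z i))): gxy; rewrite !sigmaK.
Qed.

Lemma eventually_determines_conj :
  eventually_determines psi -> eventually_determines phi.
Proof.
move=> [s s0 D]; have [g [[gc _] gs] [tK gK]] := conjugacy_sym thetac.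
have [r rg] := agree_from_map gc gs.
have [t tth] := agree_from_map thetac.1.1 thetac.2.
have Dn n : determines (iter (n * s) psi) n%:Z.
  elim: n => [|n IH] //; rewrite mulSn -addn1 PoszD addrC.
  exact: determines_iterD.
(* This power gains [1 + r + t] coordinates, of which passing to [Y] costs [t] and returning costs
   [r]. *)
exists ((1 + r + t) * s)%N; first by rewrite muln_gt0 s0.
move=> x y /tth /(determines_sigma (endomorphism_iter _ epsi) (Dn (1 + r + t)%N)).
rewrite -!(iter_conj _ _ phi_psi) => /rg; rewrite !tK.
by apply: agree_from_le; lia.
Qed.

End Conjugate.
End Side.

(** * Degrees and their limits *)

Section Supremum.
Import numFieldNormedType.Exports.
Variable R : realType.
Implicit Types (S : int -> Prop) (c k : int).
Local Open Scope ereal_scope.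

Definition isup S : \bar R := ereal_sup [set (c%:~R)%:E | c in [set c | S c]].

Lemma isup_top S (m : int) : (forall n : nat, S (n%:Z - m)%R) -> isup S = +oo.
Proof.
move=> Sn; apply: eq_infty => r; pose n := Num.bound `|r + m%:~R|%R.
have rn : (r + m%:~R <= n%:R)%R.
  exact: le_trans (ler_norm _) (ltW (archi_boundP (normr_ge0 _))).
apply: le_ereal_sup_tmp; exists ((n%:Z - m)%:~R)%:E; first by exists (n%:Z - m)%R.
by rewrite lee_fin intrB lerBrDr.
Qed.

Lemma isup_max S c : (forall c k, (c <= k)%R -> S k -> S c) ->
  S c -> ~ S (c + 1)%R -> isup S = (c%:~R)%:E.
Proof.
move=> Sle Sc nSc; apply/eqP; rewrite eq_le; apply/andP; split.
  apply: ge_ereal_sup => _ [k Sk <-]; rewrite lee_fin ler_int leNgt.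
  by apply/negP => ck; apply: nSc; apply: Sle Sk; lia.
by apply: le_ereal_sup_tmp; exists (c%:~R)%:E => //; exists c.
Qed.

Lemma isup_bot S : (forall c, ~ S c) -> isup S = -oo.
Proof.
move=> nS; rewrite /isup (_ : [set _ | _ in _] = set0) ?ereal_sup0 //.
by apply/seteqP; split=> // v [c Sc _]; case: (nS c).
Qed.

(** Treats finite and infinite limits together. The upper bound is asked for positive [s] only,
    since the quotient at 0 is a default value. *)
Lemma cvg_from_below (u : nat -> \bar R) (l : \bar R) :
  (forall s, (0 < s)%N -> u s <= l) ->
  (forall r : R, r%:E < l -> \forall s \near \oo, r%:E <= u s) ->
  u @ \oo --> l.
Proof.
move=> ul lu; case: l ul lu => [l| |] ul lu.
- apply/fine_cvgP; have near1 (e : R) : (0 < e)%R ->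
      \forall s \near \oo, (l - e)%:E <= u s <= l%:E.
    move=> e0; have /lu : (l - e)%:E < l%:E by rewrite lte_fin ltrBlDr ltrDl.
    move=> Hl; near=> s; apply/andP; split; first by near: s.
    by apply: ul; near: s; exists 1%N.
  split.
    apply: filterS (near1 1%R ltr01) => s /andP[sl su].
    by rewrite fin_numE; case: (u s) sl su.
  apply/cvgrPdist_le => e e0; apply: filterS (near1 e e0) => s /=.
  case: (u s) => [v| |]; rewrite ?leye_eq ?leeNy_eq ?andbF //= !lee_fin.
  move=> /andP[le1 lv].
  by rewrite ger0_norm ?subr_ge0 // lerBlDr -lerBlDl.
- by apply/cvgeyPge => r; apply: lu; rewrite ltry.
- apply: cvg_near_cst; exists 1%N => // s s1.
  by apply/eqP; rewrite -leeNy_eq; apply: ul.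
Unshelve. all: by end_near. Qed.

(* Fekete's lemma, for a superadditive sequence given by the sets of integers
   below its terms, which may be [-oo] or [+oo]. *)
Section Fekete.
Variable S : nat -> int -> Prop.
Hypothesis S0 : S 0 0%R.
Hypothesis Sle : forall s c k, (c <= k)%R -> S s k -> S s c.
Hypothesis SD : forall s t c k, S s c -> S t k -> S (s + t)%N (c + k)%R.
Hypothesis Sinv : forall s c, (0 < s)%N -> S s c -> exists k, S 1 k.

Lemma SM s c n : S s c -> S (n * s)%N (n%:Z * c)%R.
Proof.
move=> Ssc; elim: n => [|n IH]; first by rewrite mul0r.
by rewrite mulSn -addn1 PoszD mulrDl mul1r addrC; apply: SD.
Qed.

Definition slopes : set (\bar R) := [set v | exists s c,
  [/\ (0 < s)%N, S s c & v = (c%:~R / s%:R)%:E]].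

Lemma isup_slopes s : (0 < s)%N -> isup (S s) * (s%:R^-1)%:E <= ereal_sup slopes.
Proof.
move=> s0; have sR : (0 < s%:R :> R)%R by rewrite ltr0n.
rewrite lee_pdivrMr //; apply: ge_ereal_sup => _ [c Sc <-].
rewrite -lee_pdivrMr //; apply: ereal_sup_ge.
by exists (c%:~R / s%:R)%:E; [exists s, c|rewrite EFinM].
Qed.

(** For [s = q t + p] with [p < t], superadditivity puts [q c + p b] into [S s], where [b] belongs
    to [S 1]; the remainder [p] costs a bounded amount. *)
Lemma slopes_isup (r : R) : r%:E < ereal_sup slopes ->
  \forall s \near \oo, r%:E <= isup (S s) * (s%:R^-1)%:E.
Proof.
move=> /ereal_sup_gt[_ [t [c [t0 Stc ->]]]]; rewrite lte_fin => rct.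
have [b Sb] := Sinv t0 Stc.
have tR : (0 < t%:R :> R)%R by rewrite ltr0n.
have d0 : (0 < c%:~R - r * t%:R)%R by rewrite subr_gt0 -ltr_pdivlMr.
have tb0 : (0 <= t%:R * `|r - b%:~R| / (c%:~R - r * t%:R))%R.
  by rewrite divr_ge0 ?mulr_ge0 ?ler0n // ltW.
(* From the quotient [K] on, the surplus [K (c - r t)] outweighs the loss of at most [t |r - b|] due
   to the remainder. *)
pose K := Num.bound (t%:R * `|r - b%:~R| / (c%:~R - r * t%:R))%R.
have KP : (t%:R * `|r - b%:~R| <= K%:R * (c%:~R - r * t%:R))%R.
  by rewrite -ler_pdivrMr //; apply/ltW/archi_boundP.
exists (K * t).+1%N => // s /= Ks.
have s0 : (0 < s%:R :> R)%R by rewrite ltr0n; lia.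
rewrite lee_pdivlMr //; pose q := (s %/ t)%N; pose p := (s %% t)%N.
have sE : s = (q * t + p * 1)%N by rewrite muln1 -divn_eq.
apply: le_ereal_sup_tmp; exists ((q%:Z * c + p%:Z * b)%:~R)%:E.
  by exists (q%:Z * c + p%:Z * b)%R => //=; rewrite sE; apply: SD; apply: SM.
rewrite -EFinM lee_fin sE muln1 natrD natrM intrD !intrM.
have pt : (p%:R <= t%:R :> R)%R by rewrite ler_nat ltnW // ltn_mod.
have Kq : (K%:R <= q%:R :> R)%R by rewrite ler_nat leq_divRL //; lia.
have h1 : (p%:R * (r - b%:~R) <= t%:R * `|r - b%:~R|)%R.
  apply: (le_trans (ler_wpM2l (ler0n _ _) (ler_norm _))).
  exact: ler_wpM2r.
have h2 : (K%:R * (c%:~R - r * t%:R) <= q%:R * (c%:~R - r * t%:R))%R.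
  by apply: ler_wpM2r => //; apply: ltW.
have := le_trans h1 (le_trans KP h2).
by rewrite -[q%:~R]/(q%:R) -[p%:~R]/(p%:R); lra.
Qed.

Lemma lim_slopes (r : R) :
  r%:E < lim ((fun s => isup (S s) * (s%:R^-1)%:E) @ \oo) <->
  exists s c, [/\ (0 < s)%N, S s c & (r * s%:R < c%:~R)%R].
Proof.
have -> : lim ((fun s => isup (S s) * (s%:R^-1)%:E) @ \oo) = ereal_sup slopes.
  apply: cvg_lim => //; apply: cvg_from_below; first exact: isup_slopes.
  exact: slopes_isup.
split=> [/ereal_sup_gt[_ [t [c [t0 Stc ->]]]]|[s [c [s0 Sc rc]]]].
  rewrite lte_fin => rct; exists t, c; split=> //.
  by rewrite -ltr_pdivlMr ?ltr0n.
apply: (@lt_le_trans _ _ (c%:~R / s%:R)%:E).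
  by rewrite lte_fin ltr_pdivlMr ?ltr0n.
by apply: le_ereal_sup_tmp; exists (c%:~R / s%:R)%:E => //; exists s, c.
Qed.

Lemma lim_slopes_gt0 :
  0 < lim ((fun s => isup (S s) * (s%:R^-1)%:E) @ \oo) <->
  exists2 s, (0 < s)%N & S s 1%R.
Proof.
split=> [/lim_slopes[s [c [s0 Sc]]]|[s s0 Ss]]; last first.
  by apply/lim_slopes; exists s, 1%R; rewrite mul0r ltr01.
rewrite mul0r ltr0z => c0; exists s => //; apply: Sle Sc; lia.
Qed.

(** For [T] the degrees of [phi^i sigma^j]. A slope [c / t] above [- k / i] means [- k t < i c],
    that is [1 - k t <= i c] for integers, and [i c] lies in [S (i t)]. *)
Lemma lim_slopes_skew (T : nat -> int -> Prop) (i : nat) (k : int) :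
  (0 < i)%N -> (forall s c, T s c <-> S (i * s)%N (c - k * s%:Z)%R) ->
  (- k%:~R / i%:R)%:E < lim ((fun s => isup (S s) * (s%:R^-1)%:E) @ \oo) <->
  exists2 s, (0 < s)%N & T s 1%R.
Proof.
move=> i0 TS; have iR : (0 < i%:R :> R)%R by rewrite ltr0n.
split=> [/lim_slopes[t [c [t0 Sc]]]|[s s0 /TS Ss]].
  rewrite mulrAC ltr_pdivrMr // -[t%:R]/(t%:~R) -[i%:R]/(i%:~R) -intrN -!intrM.
  rewrite ltr_int => kc.
  exists t => //; apply/TS; apply: Sle (SM i Sc); lia.
apply/lim_slopes; exists (i * s)%N, (1 - k * s%:Z)%R; split=> //.
  by rewrite muln_gt0 i0.
rewrite natrM mulrA mulfVK ?gt_eqF // -[s%:R]/(s%:~R) -intrN -intrM ltr_int; lia.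
Qed.

End Fekete.
End Supremum.

(** * Existence of local rules *)

Section Words.
Variables (A : finType) (X : subshift A).

Lemma tnth_word (N : nat) (a : fullshift A) s (k : 'I_N.+1) :
  tnth (word N a s) k = a (s + k%:Z).
Proof. by rewrite tnth_mktuple. Qed.

Lemma eq_word (N : nat) (a b : fullshift A) s t :
  (forall k : nat, (k <= N)%N -> a (s + k%:Z) = b (t + k%:Z)) ->
  word N a s = word N b t.
Proof.
by move=> ab; apply: eq_from_tnth => k; rewrite !tnth_word ab // -ltnS.
Qed.

(** On an occurring word the rule reads off the image of any point realizing it, which is well
    defined by [block_map]; other words get the default letter [a0]. *)
Lemma of_type_exists (phi : X -> X) : (0 < #|A|)%N -> endomorphism phi ->
  exists m n f, @of_type A X m n f phi.
Proof.
move=> /card_gt0P[a0 _] [phic phis]; have [r rf] := block_map phic phis.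
pose f w := if pselect (exists x : X, w = word (r + r) (\val x) (- r%:Z)) is left h
  then \val (phi (projT1 (cid h))) 0 else a0.
have fE x (j : int) : f (word (r + r) (\val x) (j - r%:Z)) = \val (phi x) j.
  have wE : word (r + r) (\val x) (j - r%:Z) =
            word (r + r) (\val (sigma j x)) (- r%:Z).
    by apply: eq_word => k _; rewrite val_sigma; congr (\val x _); lia.
  rewrite /f; case: pselect => [h|[]]; last by exists (sigma j x).
  case: (cid h) => y /= yE.
  rewrite -[j]add0r -val_sigma -(equivariant phis); apply: rf => l lr.
  have lk : (absz (l + r%:Z)%R < (r + r).+1)%N by lia.
  have := congr1 (fun w => tnth w (Ordinal lk)) yE.
  rewrite wE /= !tnth_word /=.
  by have -> : - r%:Z + (absz (l + r%:Z))%:Z = l by lia.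
exists r, r, f; split=> // x.
suff -> : (fun j => f (word (r + r) (\val x) j)) = \val (sigma r%:Z (phi x)).
  exact: pointP.
by apply/funext => j; rewrite val_sigma -fE; congr (f (word _ _ _)); lia.
Qed.

End Words.

(** * Asymptotic points and determinism in finite subshifts *)

Section FiniteSubshift.
Variables (e : int).
Hypothesis ee : e * e = 1.
Variables (A : finType) (X : subshift A).

(** By the pigeonhole principle two shifts of the pair [(x, y)] coincide. Both points then have a
    common period, which carries the agreement far out to every coordinate. *)
Lemma finite_asymptotic (x y : X) a : finite_set (points X) ->
  agree_from e a x y -> x = y.
Proof.
move=> Xfin xy.
have : ~ injective (fun n : nat =>
    (\val (sigma (e * n%:Z) x), \val (sigma (e * n%:Z) y))).
  move=> inj; apply: infinite_nat.
  have := @finite_preimage _ _ (points X `*` points X) _ (in2W inj)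
    (finite_setX Xfin Xfin).
  by apply: sub_finite_set => n _; split; apply: pointP.
move=> /existsNP[m1 /existsNP[m2 /not_implyP[mm m12]]].
have [n1 [n2 [n12 [xn yn]]]] : exists n1 n2, (n1 < n2)%N /\
    (sval (sigma (e * n1%:Z) x), sval (sigma (e * n1%:Z) y)) =
    (sval (sigma (e * n2%:Z) x), sval (sigma (e * n2%:Z) y)).
  by have [|lt|//] := ltngtP m1 m2; [exists m1, m2|exists m2, m1].
have per (z : X) (j : int) (k : nat) :
    Defs.shift (e * n1%:Z) (\val z) = Defs.shift (e * n2%:Z) (\val z) ->
    \val z (e * (j + ((n2 - n1) * k)%N%:Z)) = \val z (e * j).
  move=> zn; elim: k => [|k IH]; first by rewrite muln0 addr0.
  have := congr1 (fun w : fullshift A =>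
    w (e * (j + ((n2 - n1) * k)%N%:Z) - e * n1%:Z)) zn.
  rewrite /Defs.shift subrK IH => ->; congr (\val z _).
  by rewrite -mulrN -!mulrDr; congr (_ * _); rewrite mulnS; lia.
apply: eq_point => j; rewrite -(mulee ee j).
pose k := (absz a + absz j)%N; rewrite -(per x _ k) // -(per y _ k) //.
have kk : (k <= (n2 - n1) * k)%N by rewrite leq_pmull // subn_gt0.
apply: xy; rewrite -{1}(mulee ee j).
by rewrite /k in kk *; case: (sideP ee) => ->; lia.
Qed.

(** By compactness a coordinate is a function of the next [M] ones, so shifting induces a self-map
    of the words of length [M]. It is onto, hence injective, so such a word determines its point in
    both directions. *)
Lemma deterministic_finite :
  (forall x y : X, agree_from e 1 x y -> agree_from e 0 x y) ->
  finite_set (points X).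
Proof.
move=> det.
have [M detM] : exists M : nat, forall x y : X,
    (forall j, 1 <= j <= M%:Z -> \val x (e * j) = \val y (e * j)) ->
    \val x (e * 0) = \val y (e * 0).
  apply: (@compactness _ _ (fun M x y => forall j, 1 <= j <= M%:Z ->
    \val x (e * j) = \val y (e * j))
    (fun x y => \val x (e * 0) = \val y (e * 0))).
  - by move=> k l x y kl xy j jk; apply: xy; lia.
  - by move=> k u v uv j jk; apply: plim_eq_at; apply: filterS uv => n; apply.
  - by move=> u v; apply: eq_at_open.
  - move=> x y xy; apply: det => // j j1; apply: (xy (absz j)); lia.
have [X0|/set0P[a Xa]] := eqVneq (points X) set0; first by rewrite X0.
pose x0 := point Xa.
pose w (x : X) : {ffun 'I_M -> A} := [ffun k : 'I_M => \val x (e * (1 + (k : nat)%:Z))].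
have wP x y : w x = w y <->
    (forall j, 1 <= j <= M%:Z -> \val x (e * j) = \val y (e * j)).
  split=> [/ffunP wxy j jM|xy].
    have jM' : (absz (j - 1)%R < M)%N by lia.
    have := wxy (Ordinal jM'); rewrite !ffunE /=.
    by have -> : 1 + (absz (j - 1))%:Z = j by lia.
  by apply/ffunP => k; rewrite !ffunE; apply: xy; have := ltn_ord k; lia.
pose rep v := xget x0 [set x | w x = v].
have wrep x : w (rep (w x)) = w x.
  exact: (@xgetPex _ x0 [set y | w y = w x] (ex_intro _ x erefl)).
pose V := [set v : {ffun 'I_M -> A} | `[< exists x, w x = v >]]%SET.
have VP v : v \in V <-> exists x, w x = v by rewrite inE; split=> /asboolP.
have eN (x : X) j : \val (sigma (- e) x) (e * j) = \val x (e * (j - 1)).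
  by rewrite val_sigma; congr (\val x _); rewrite mulrBr mulr1.
have step x y : w x = w y -> w (sigma (- e) x) = w (sigma (- e) y).
  move=> /wP xy; apply/wP => j jM; rewrite !eN.
  by have [->|j1] := eqVneq j 1; [exact: detM|apply: xy; lia].
pose t v := w (sigma (- e) (rep v)).
have tw x : t (w x) = w (sigma (- e) x) by apply: step; rewrite wrep.
have tV : [set t v | v in V]%SET = V.
  apply/setP => v; apply/imsetP/idP => [[v1 _ ->]|/VP[x <-]].
    by apply/VP; exists (sigma (- e) (rep v1)).
  by exists (w (sigma e x)); [apply/VP; exists (sigma e x)|rewrite tw sigmaK].
(* A surjective self-map of a finite set is injective; this gives determinism in the opposite
   direction. *)
have tinj : {in V &, injective t} by apply/imset_injP; rewrite tV.
have back x y : w (sigma (- e) x) = w (sigma (- e) y) -> w x = w y.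
  by rewrite -!tw => /tinj; apply; apply/VP; [exists x|exists y].
have both x y (k : nat) : w x = w y ->
    w (sigma (- e * k%:Z) x) = w (sigma (- e * k%:Z) y) /\
    w (sigma (e * k%:Z) x) = w (sigma (e * k%:Z) y).
  move=> wxy; elim: k => [|k [IH1 IH2]]; first by rewrite !mulr0 !sigma0.
  split.
    rewrite -addn1 PoszD mulrDr mulr1 addrC -!sigmaD; exact: step.
  by apply: back; rewrite !sigmaD -addn1 PoszD mulrDr mulr1 addrC addrK.
have winj x y : w x = w y -> x = y.
  move=> wxy; apply: eq_point => j; rewrite -(mulee ee j).
  have [b1 b2] := both x y (absz (e * j)) wxy.
  suff /wP/detM : w (sigma (e * (e * j)) x) = w (sigma (e * (e * j)) y).
    by rewrite !val_sigma mulr0 !add0r.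
  have [je|je] := lerP 0 (e * j).
    by have -> : e * j = (absz (e * j))%:Z by lia.
  have -> : e * j = - (absz (e * j))%:Z by lia.
  by rewrite mulrN -mulNr.
apply: (@sub_finite_set _ _ ((fun v => \val (rep v)) @` setT)); last first.
  by apply: finite_image; apply: finite_finset.
move=> b Xb; exists (w (point Xb)) => //.
by rewrite (winj (rep (w (point Xb))) (point Xb)).
Qed.

End FiniteSubshift.

(** * The degrees defined by local rules as suprema *)

Section Pointwise.
Variables (e : int).
Hypothesis ee : e * e = 1.
Variables (A : finType) (X : subshift A) (phi : X -> X).
Hypothesis ephi : endomorphism phi.

Lemma determines_at c : determines e phi c <-> forall x y, agree_from e 0 x y ->
  \val (phi x) (e * - c) = \val (phi y) (e * - c).
Proof.
split=> [D x y /D|D x y xy j cj]; first by apply.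
have xyj : agree_from e 0 (sigma (e * (j + c)) x) (sigma (e * (j + c)) y).
  by apply/agree_from_sigma; apply: agree_from_le xy; lia.
have := D _ _ xyj; rewrite !(equivariant ephi.2) !val_sigma -mulrDr.
by have -> : - c + (j + c) = j by lia.
Qed.

(** Mergibility recovers one coordinate from agreement right next to it; agreement from an arbitrary
    [a] is treated by descending one coordinate at a time. *)
Lemma recovers_at c : recovers e phi c <-> forall x y, agree_from e 0 x y ->
  agree_from e (c - 1) (phi x) (phi y) -> \val x (e * - 1) = \val y (e * - 1).
Proof.
split=> [E x y xy fxy|E x y a xya fxy].
  exact: (recovers_sigma ephi E xy fxy).
have : agree_from e (absz a)%:Z x y by apply: agree_from_le xya; lia.
elim: (absz a) => [//|n IH] xyn; apply: IH.
have -> : n%:Z = n.+1%:Z - 1 by lia.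
apply: agree_from_pred => //.
have := E (sigma (e * n.+1%:Z) x) (sigma (e * n.+1%:Z) y).
rewrite !val_sigma -mulrDr addrC; apply; first exact/agree_from_sigma.
rewrite !(equivariant ephi.2); apply/agree_from_sigma.
by apply: agree_from_le fxy; lia.
Qed.

End Pointwise.

Section Specification.
Variables (R : realType) (A : finType) (X : subshift A) (phi : X -> X).
Hypothesis A0 : (0 < #|A|)%N.
Hypothesis ephi : endomorphism phi.

Lemma strict_redundant (P : nat -> Prop) : P 0%N ->
  exists I : option nat, if I is Some n then P n /\ ~ P n.+1 else forall n, P n.
Proof.
move=> P0; have [Pn|/existsNP[n nPn]] := pselect (forall n, P n).
  by exists None.
elim: n nPn => [//|n IH] nPn.
by have [Pn|/IH //] := pselect (P n); exists (Some n).
Qed.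

Lemma strict_mergible (P : nat -> Prop) :
  exists k : option nat, if k is Some n then P n /\ forall n', P n' -> (n <= n')%N
    else forall n, ~ P n.
Proof.
have [[n Pn]|nP] := pselect (exists n, P n); last first.
  by exists None => n Pn; apply: nP; exists n.
have exP : exists n, `[< P n >] by exists n; apply/asboolP.
have [m /asboolP Pm mmin] := ex_minnP exP.
by exists (Some m); split=> // k /asboolP; apply: mmin.
Qed.

Lemma redundant_isup (S : int -> Prop) (P : nat -> Prop) (m : nat) I :
  (forall c k, c <= k -> S k -> S c) -> (forall n, P n <-> S (n%:Z - m%:Z)) ->
  (if I is Some n then P n /\ ~ P n.+1 else forall n, P n) ->
  (ext R I - m%:R%:E)%E = isup R S.
Proof.
move=> Sle PS; case: I => [n [/PS Pn nPn]|nP] /=.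
  rewrite (isup_max _ Sle Pn) ?intrB // => Sn; apply: nPn; apply/PS.
  by apply: Sle Sn; lia.
by rewrite (@isup_top _ _ m%:Z) // => n; apply/PS.
Qed.

(** The least [n] gives the largest element [m - n] of [S]. For [n = 0] minimality says nothing, and
    the hypothesis on [m + 1] provides the maximality. *)
Lemma mergible_isup (S : int -> Prop) (P : nat -> Prop) (m : nat) k :
  (forall c k, c <= k -> S k -> S c) -> (forall n, P n <-> S (m%:Z - n%:Z)) ->
  ~ S (m%:Z + 1) ->
  (if k is Some n then P n /\ forall n', P n' -> (n <= n')%N
   else forall n, ~ P n) ->
  (m%:R%:E - ext R k)%E = isup R S.
Proof.
move=> Sle PS Sm; case: k => [n [/PS Pn nmin]|nP] /=.
  rewrite (isup_max _ Sle Pn) ?intrB //.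
  case: n Pn nmin => [|n] Pn nmin; first by rewrite subr0.
  have -> : m%:Z - n.+1%:Z + 1 = m%:Z - n%:Z by lia.
  by move=> /PS /nmin; rewrite ltnn.
rewrite isup_bot // => c Sc; apply: (nP (absz (m%:Z - c))); apply/PS.
by apply: Sle Sc; lia.
Qed.

Lemma determines_left_redundant m n f I : @of_type A X m n f phi ->
  left_redundant X f I <-> determines 1 phi (I%:Z - m%:Z).
Proof.
move=> [_ fphi]; have fE x : f (word (m + n) (\val x) (- I%:Z)) =
    \val (phi x) (1 * - (I%:Z - m%:Z)).
  by rewrite fphi; congr (f (word _ _ _)); lia.
rewrite (determines_at _ ephi) //; split=> red x y xy.
  rewrite -!fE; apply: red => j j0.
  by have := xy j j0; rewrite mul1r.
by rewrite !fE; apply: red => j j0; rewrite mul1r xy.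
Qed.

Lemma determines_right_redundant m n f J : @of_type A X m n f phi ->
  right_redundant X f J <-> determines (- 1) phi (J%:Z - n%:Z).
Proof.
move=> [_ fphi]; have fE x : f (word (m + n) (\val x) (J%:Z - (m + n)%N%:Z)) =
    \val (phi x) (- 1 * - (J%:Z - n%:Z)).
  by rewrite fphi; congr (f (word _ _ _)); lia.
rewrite (determines_at _ ephi) //; split=> red x y xy.
  rewrite -!fE; apply: red => j j0.
  by have := xy (- j); rewrite mulN1r opprK; apply; lia.
by rewrite !fE; apply: red => j j0; rewrite mulN1r xy // oppr_le0.
Qed.

Lemma recovers_right_mergible m n f k : @of_type A X m n f phi ->
  right_mergible X f k <-> recovers (- 1) phi (n%:Z - k%:Z).
Proof.
move=> [_ fphi]; have fE x (j : int) : f (word (m + n) (\val x) (j - (m + n)%N%:Z)) =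
    \val (phi x) (j - n%:Z).
  by rewrite fphi; congr (f (word _ _ _)); lia.
rewrite (recovers_at _ ephi) //; split=> mer x y xy fxy.
  rewrite mulN1r opprK; apply: mer => j jk.
    by have := xy (- j); rewrite mulN1r opprK; apply; lia.
  by rewrite !fE; have := fxy (n%:Z - j%:Z); rewrite mulN1r opprB; apply; lia.
suff: \val x (- 1 * - 1) = \val y (- 1 * - 1) by [].
apply: mer => j j0; first by rewrite mulN1r xy // oppr_le0.
(* For [j >= n] the window lies where the points agree; the [k.+1] coordinates left are those
   compared by mergibility. *)
rewrite mulN1r; have [nj|jn] := lerP n%:Z j.
  rewrite !fphi; congr f; apply: eq_word => l ln; apply: xy; lia.
have := fxy (absz (n%:Z - j)); have jE : (absz (n%:Z - j))%:Z = n%:Z - j by lia.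
rewrite !fE jE; have -> : n%:Z - j - n%:Z = - j by lia.
by apply; lia.
Qed.

Lemma recovers_left_mergible m n f k : @of_type A X m n f phi ->
  left_mergible X f k <-> recovers 1 phi (m%:Z - k%:Z).
Proof.
move=> [_ fphi]; have fE x (j : int) : f (word (m + n) (\val x) j) =
    \val (phi x) (j + m%:Z).
  by rewrite fphi; congr (f (word _ _ _)); lia.
rewrite (recovers_at _ ephi) //; split=> mer x y xy fxy.
  rewrite mul1r; apply: mer => j jk.
    by have := xy j jk; rewrite mul1r.
  by rewrite !fE; have := fxy (- j%:Z + m%:Z); rewrite mul1r; apply; lia.
suff: \val x (1 * - 1) = \val y (1 * - 1) by [].
apply: mer => j j0; first by rewrite mul1r xy.
rewrite mul1r; have [nj|jn] := lerP m%:Z j.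
  rewrite !fphi; congr f; apply: eq_word => l ln; apply: xy; lia.
have := fxy (absz (m%:Z - j)); have jE : (absz (m%:Z - j))%:Z = m%:Z - j by lia.
rewrite !fE jE; have -> : - (m%:Z - j) + m%:Z = j by lia.
by apply; lia.
Qed.

(** Recovery from images that the coordinates from 1 on already determine would make the coordinate
    0 a function of these, forcing [X] to be finite. *)
Lemma infinite_recovers e (c : int) : e * e = 1 -> infinite_set (points X) ->
  (forall x y, agree_from e 1 x y -> agree_from e (c + 1) (phi x) (phi y)) ->
  ~ recovers e phi (c + 1).
Proof.
move=> ee Xinf det E; apply: Xinf; apply: (deterministic_finite ee) => x y xy.
exact: E xy (det _ _ xy).
Qed.

Lemma finite_recovers e c : e * e = 1 -> finite_set (points X) ->
  recovers e phi c.
Proof. by move=> ee Xfin x y a /(finite_asymptotic ee Xfin) ->. Qed.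

(** Every element of the specification equals the supremum, whichever rule it comes from, and an
    element exists, so the default of [xget] is not taken. The next three lemmas follow the same
    pattern. *)
Lemma P_L_isup : P_L R phi = isup R (determines 1 phi).
Proof.
have spec (v : \bar R) : P_L_spec phi v -> v = isup R (determines 1 phi).
  move=> [m [n [f [I [type strict ->]]]]].
  apply: (redundant_isup _ (fun I => determines_left_redundant I type)) strict.
  by move=> c k; apply: determines_le.
apply: spec; apply: (@xgetPex _ 0%E (P_L_spec phi)).
have [m [n [f type]]] := of_type_exists A0 ephi.
have [|I strict] := @strict_redundant (left_redundant X f); last first.
  by exists (ext R I - m%:R%:E)%E, m, n, f, I.
move=> x y xy; congr f; apply: eq_word => k kN; apply: xy; lia.
Qed.

Lemma P_R_isup : P_R R phi = isup R (determines (- 1) phi).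
Proof.
have spec (v : \bar R) : P_R_spec phi v -> v = isup R (determines (- 1) phi).
  move=> [m [n [f [I [type strict ->]]]]].
  apply: (redundant_isup _ (fun I => determines_right_redundant I type)) strict.
  by move=> c k; apply: determines_le.
apply: spec; apply: (@xgetPex _ 0%E (P_R_spec phi)).
have [m [n [f type]]] := of_type_exists A0 ephi.
have [|I strict] := @strict_redundant (right_redundant X f); last first.
  by exists (ext R I - n%:R%:E)%E, m, n, f, I.
move=> x y xy; congr f; apply: eq_word => k kN; apply: xy; lia.
Qed.

Lemma Q_R_isup : Q_R R phi = isup R (recovers (- 1) phi).
Proof.
have spec (v : \bar R) : Q_R_spec phi v -> v = isup R (recovers (- 1) phi).
  move=> [[Xfin ->]|[Xinf [m [n [f [k [type strict ->]]]]]]].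
    by rewrite (@isup_top _ _ 0) // => n; apply: finite_recovers.
  apply: (mergible_isup _ (fun k => recovers_right_mergible k type)) strict.
    by move=> c l; apply: recovers_le.
  apply: infinite_recovers => // x y xy j nj.
  case: type => _ fphi; rewrite !fphi; congr f; apply: eq_word => l ln.
  have := xy (- (- 1 * j - m%:Z + l%:Z)).
  by rewrite [_ * - _]mulN1r opprK; apply; lia.
apply: spec; apply: (@xgetPex _ 0%E (Q_R_spec phi)).
have [Xfin|Xinf] := pselect (finite_set (points X)).
  by exists +oo%E; left.
have [m [n [f type]]] := of_type_exists A0 ephi.
have [k strict] := strict_mergible (right_mergible X f).
by exists (n%:R%:E - ext R k)%E; right; split=> //; exists m, n, f, k.
Qed.

Lemma Q_L_isup : Q_L R phi = isup R (recovers 1 phi).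
Proof.
have spec (v : \bar R) : Q_L_spec phi v -> v = isup R (recovers 1 phi).
  move=> [[Xfin ->]|[Xinf [m [n [f [k [type strict ->]]]]]]].
    by rewrite (@isup_top _ _ 0) // => l; apply: finite_recovers.
  apply: (mergible_isup _ (fun k => recovers_left_mergible k type)) strict.
    by move=> c l; apply: recovers_le.
  apply: infinite_recovers => // x y xy j nj.
  case: type => _ fphi; rewrite !fphi; congr f; apply: eq_word => l ln.
  by have := xy (j - m%:Z + l%:Z); rewrite !mul1r; apply; lia.
apply: spec; apply: (@xgetPex _ 0%E (Q_L_spec phi)).
have [Xfin|Xinf] := pselect (finite_set (points X)).
  by exists +oo%E; left.
have [m [n [f type]]] := of_type_exists A0 ephi.
have [k strict] := strict_mergible (left_mergible X f).
by exists (m%:R%:E - ext R k)%E; right; split=> //; exists m, n, f, k.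
Qed.

End Specification.

(** * Limits of degrees and their change under [phi^i sigma^j] *)

Section Rates.
Variables (R : realType) (A : finType) (X : subshift A) (phi : X -> X).
Hypothesis ephi : endomorphism phi.
Local Open Scope ereal_scope.

Definition determines_rate (e : int) : \bar R :=
  lim ((fun s : nat => isup R (determines e (iter s phi)) * (s%:R^-1)%:E) @ \oo).

Definition recovers_rate (e : int) : \bar R :=
  lim ((fun s : nat => isup R (recovers e (iter s phi)) * (s%:R^-1)%:E) @ \oo).

Lemma endomorphism_power_shift i j : endomorphism (power_shift phi i j).
Proof.
have [phic phis] := ephi; split; last first.
  by move=> x; rewrite /power_shift !sigmaD addrC -sigmaD (endomorphism_iter i ephi).2.
move=> x; apply: (@continuous_comp _ _ _ (sigma j) (iter i phi)).
  apply: (@continuous_block _ _ X X) => [y|]; first by rewrite !sigmaD addrC.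
  by exists `|j|%N => y z; rewrite !val_sigma; apply; lia.
exact: (endomorphism_iter i ephi).1.
Qed.

Lemma iter_power_shift i j s x : iter s (power_shift phi i j) x =
  sigma (j * s%:Z)%R (iter (i * s) phi x).
Proof.
elim: s => [|s IH]; first by rewrite muln0 mulr0 sigma0.
rewrite iterS IH /power_shift sigmaD (equivariant (endomorphism_iter i ephi).2).
by rewrite -iterD -mulnS; congr (sigma _ _); lia.
Qed.

Section Side.
Variable e : int.
Hypothesis ee : (e * e = 1)%R.

Lemma determines_rate_gt0 : 0 < determines_rate e <-> eventually_determines e phi.
Proof.
apply: lim_slopes_gt0 => [|s c k|s t c k|s c _ _].
- exact: determines_iter0.
- exact: determines_le.
- exact: determines_iterD.
- exact: (determines_bound ee ephi).
Qed.

Lemma recovers_rate_gt0 : 0 < recovers_rate e <-> eventually_recovers e phi.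
Proof.
apply: lim_slopes_gt0 => [|s c k|s t c k|s c].
- exact: recovers_iter0.
- exact: recovers_le.
- exact: recovers_iterD.
- exact: recovers_iter_inv.
Qed.

(** A shift by [j] moves half-lines of side [e] by [e * j]. It raises the degree of determination
    and lowers that of recovery, whence the opposite signs in the two lemmas. *)
Lemma determines_power_shift i j s c :
  determines e (iter s (power_shift phi i j)) c <->
  determines e (iter (i * s) phi) (c - (e * j) * s%:Z)%R.
Proof.
have jE : (j * s%:Z = e * (e * j * s%:Z))%R by rewrite -!mulrA (mulee ee).
split=> D x y /D; rewrite ?iter_power_shift jE ?(agree_from_sigma ee);
  rewrite ?iter_power_shift ?jE.
  by move/agree_from_sigma; apply: agree_from_le; lia.
by move=> xy; apply/agree_from_sigma; apply: agree_from_le xy; lia.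
Qed.

Lemma recovers_power_shift i j s c :
  recovers e (iter s (power_shift phi i j)) c <->
  recovers e (iter (i * s) phi) (c - (- (e * j)) * s%:Z)%R.
Proof.
have jE : (j * s%:Z = e * (e * j * s%:Z))%R by rewrite -!mulrA (mulee ee).
split=> E x y a xy fxy; apply: (E _ _ _ xy).
  rewrite !iter_power_shift jE; apply/agree_from_sigma.
  by apply: agree_from_le fxy; lia.
move: fxy; rewrite !iter_power_shift jE => /agree_from_sigma.
by apply: agree_from_le; lia.
Qed.

Lemma determines_rate_skew i j : (0 < i)%N ->
  (- (e * j)%:~R / i%:R)%:E < determines_rate e <->
  eventually_determines e (power_shift phi i j).
Proof.
move=> i0; apply: (@lim_slopes_skew R (fun s => determines e (iter s phi)) _ _ _ _
  (fun s => determines e (iter s (power_shift phi i j))) i (e * j)%R i0).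
- exact: determines_iter0.
- by move=> s c k; exact: determines_le.
- by move=> s t c k; exact: determines_iterD.
- by move=> s c _ _; exact: (determines_bound ee ephi).
- by move=> s c; exact: determines_power_shift.
Qed.

Lemma recovers_rate_skew i j : (0 < i)%N ->
  ((e * j)%:~R / i%:R)%:E < recovers_rate e <->
  eventually_recovers e (power_shift phi i j).
Proof.
move=> i0; rewrite -[(e * j)%:~R]opprK -intrN.
apply: (@lim_slopes_skew R (fun s => recovers e (iter s phi)) _ _ _ _
  (fun s => recovers e (iter s (power_shift phi i j))) i (- (e * j))%R i0).
- exact: recovers_iter0.
- by move=> s c k; exact: recovers_le.
- by move=> s t c k; exact: recovers_iterD.
- by move=> s c; exact: recovers_iter_inv.
- by move=> s c; exact: recovers_power_shift.
Qed.

End Side.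

Hypothesis A0 : (0 < #|A|)%N.

Lemma p_L_rate : p_L R phi = determines_rate 1.
Proof.
rewrite /p_L /determines_rate; congr (lim (_ @ \oo)); apply/funext => s.
by rewrite P_L_isup //; apply: endomorphism_iter.
Qed.

Lemma p_R_rate : p_R R phi = determines_rate (- 1).
Proof.
rewrite /p_R /determines_rate; congr (lim (_ @ \oo)); apply/funext => s.
by rewrite P_R_isup //; apply: endomorphism_iter.
Qed.

Lemma q_R_rate : q_R R phi = recovers_rate (- 1).
Proof.
rewrite /q_R /recovers_rate; congr (lim (_ @ \oo)); apply/funext => s.
by rewrite Q_R_isup //; apply: endomorphism_iter.
Qed.

Lemma q_L_rate : q_L R phi = recovers_rate 1.
Proof.
rewrite /q_L /recovers_rate; congr (lim (_ @ \oo)); apply/funext => s.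
by rewrite Q_L_isup //; apply: endomorphism_iter.
Qed.

End Rates.

(** * Metric expansiveness as agreement on half-lines *)

Section Metric.
Variables (R : realType) (A : finType) (X : subshift A) (d : X -> X -> R).
Hypothesis hd : compatible_metric d.

Lemma plim_metric (u : nat -> X) (r : R) : 0 < r ->
  ultra [set n | d (plim u) (u n) < r].
Proof.
move=> r0; have [_ _ _ dn] := hd.
have /nbhs_subshiftP[s sr] : nbhs (plim u) [set y | d (plim u) y < r].
  by apply/dn; exists r.
by apply: filterS (plim_upto u s) => n /sr.
Qed.

(** Counterexamples for growing windows would have a common limit, close to both points of some
    pair. *)
Lemma metric_close (r : R) : 0 < r -> exists s, forall x y : X,
  agree_upto s (\val x) (\val y) -> d x y <= r.
Proof.
have [_ dC dD _] := hd => r0; apply: contrapT => /forallNP nQ.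
have /choice[u /choice[v uv]] n : exists x, exists y : X,
    agree_upto n (\val x) (\val y) /\ ~ d x y <= r.
  have /existsNP[x /existsNP[y /not_implyP xy]] := nQ n.
  by exists x, y.
have puv : plim u = plim v.
  apply: plim_eq => j; apply: filterS (ultra_ge `|j|%N) => n /= jn.
  by apply: (uv n).1; lia.
have r2 : 0 < r / 2 by rewrite divr_gt0.
have [n [/= du dv]] := filter_ex (filterI (plim_metric u r2) (plim_metric v r2)).
apply: (uv n).2; apply: le_trans (dD _ (plim u) _) _.
rewrite dC {2}puv; lra.
Qed.

(** Pairs at distance at most [1 / (n + 1)] differing at 0 would have limits at distance 0 that
    still differ at 0. *)
Lemma metric_separates : exists2 r : R, 0 < r & forall x y : X,
  d x y <= r -> \val x 0 = \val y 0.
Proof.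
have [d0 dC dD _] := hd; apply: contrapT => nQ.
have /choice[u /choice[v uv]] (n : nat) : exists x, exists y : X,
    d x y <= n.+1%:R^-1 /\ \val x 0 <> \val y 0.
  apply: contrapT => nxy; apply: nQ; exists n.+1%:R^-1.
    by rewrite invr_gt0 ltr0n.
  move=> x y xy; apply: contrapT => xy0; apply: nxy.
  by exists x, y.
have dge0 x y : 0 <= d x y.
  by have := dD x y x; rewrite (d0 x x).2 // [d y x]dC; lra.
have puv : plim u = plim v.
  apply/d0; apply/eqP; rewrite eq_le dge0 andbT leNgt; apply/negP => D0.
  pose D := d (plim u) (plim v); have D3 : 0 < D / 3 by rewrite divr_gt0.
  have D3' : 0 <= (D / 3)^-1 by rewrite invr_ge0 ltW.
  pose N := Num.bound (D / 3)^-1; have DN := archi_boundP D3'.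
  have [n [/= du [dv nN]]] := filter_ex (filterI (plim_metric u D3)
    (filterI (plim_metric v D3) (ultra_ge N))).
  have n3 : n.+1%:R^-1 <= D / 3.
    rewrite -[leRHS]invrK lef_pV2 ?posrE ?invr_gt0 ?ltr0n //.
    by apply: le_trans (ltW DN) _; rewrite ler_nat; apply: leq_trans nN _.
  have h1 := dD (plim u) (u n) (plim v); have h2 := dD (u n) (v n) (plim v).
  have h3 := le_trans (uv n).1 n3; rewrite [d (v n) _]dC in h2.
  move: h1 h2 h3 du dv; rewrite -/D; clear; lra.
have [n [/= eu ev]] := filter_ex (filterI (plimE u 0) (plimE v 0)).
apply: (uv n).2; rewrite [LHS]eu [RHS]ev.
by rewrite -[ulim _]/(\val (plim u)) puv.
Qed.

Definition close (e : int) (r : R) (x y : X) : Prop :=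
  forall j : int, 0 <= j -> d (sigma (e * j) x) (sigma (e * j) y) <= r.

Section Side.
Variable e : int.
Hypothesis ee : e * e = 1.

Lemma close_agree : exists2 r : R, 0 < r & forall x y : X,
  close e r x y -> agree_from e 0 x y.
Proof.
have [r r0 rd] := metric_separates; exists r => // x y xy j j0.
by rewrite -[e * j]add0r -!val_sigma; apply/rd/xy.
Qed.

(** After a shift by [s] along side [e], the windows of radius [s] around all later coordinates lie
    in the half-line of agreement. *)
Lemma agree_close (r : R) : 0 < r -> exists s : nat, forall x y : X,
  agree_from e 0 x y -> close e r (sigma (e * s%:Z) x) (sigma (e * s%:Z) y).
Proof.
move=> /metric_close[s sd]; exists s => x y xy j j0; apply: sd => k ks.
rewrite !val_sigma -{1 2}(mulee ee k) -!mulrDr; apply: xy.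
by case: (sideP ee) => ->; lia.
Qed.

Variable phi : X -> X.
Hypothesis ephi : endomorphism phi.

Lemma metric_expansive :
  (exists2 r : R, 0 < r & forall x y : int -> X,
    is_orbit phi x -> is_orbit phi y -> (forall i, close e r (x i) (y i)) ->
    x = y) <-> expansive e phi.
Proof.
split=> [[r r0 ex] x y xo yo xy|ex].
  have [s sd] := agree_close r0.
  have orbit z : is_orbit phi z ->
      is_orbit phi (fun i => sigma (e * s%:Z) (z i)).
    by move=> zo i; rewrite (equivariant ephi.2) zo.
  have xys := ex _ _ (orbit _ xo) (orbit _ yo) (fun i => sd _ _ (xy i)).
  apply/funext => i.
  by move/(congr1 (fun z => sigma (- (e * s%:Z)) (z i))): xys; rewrite !sigmaK.
have [r r0 rd] := close_agree; exists r => // x y xo yo xy.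
by apply: ex => // i; apply: rd.
Qed.

Lemma metric_positively_expansive :
  (exists2 r : R, 0 < r & forall x y : X,
    (forall i, close e r (iter i phi x) (iter i phi y)) -> x = y) <->
  positively_expansive e phi.
Proof.
split=> [[r r0 ex] x y xy|ex].
  have [s sd] := agree_close r0.
  suff: sigma (e * s%:Z) x = sigma (e * s%:Z) y.
    by move=> /(congr1 (sigma (- (e * s%:Z)))); rewrite !sigmaK.
  apply: ex => i; rewrite !(equivariant (endomorphism_iter i ephi).2).
  exact: sd (xy i).
have [r r0 rd] := close_agree; exists r => // x y xy.
by apply: ex => i; apply: rd.
Qed.

End Side.

Variable phi : X -> X.
Hypothesis ephi : endomorphism phi.

Lemma closeP e r x y : e * e = 1 -> close e r x y <->
  forall j : int, 0 <= e * j -> d (sigma j x) (sigma j y) <= r.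
Proof.
move=> ee; split=> xy j j0; last by apply: xy; rewrite mulee.
by rewrite -(mulee ee j); apply: xy.
Qed.

Lemma right_expansiveP : right_expansive d phi <-> expansive 1 phi.
Proof.
rewrite -(metric_expansive _ ephi) //; split=> -[r r0 ex]; exists r =>
  // x y xo yo xy; apply: ex => // i; first move=> j j0; last apply/closeP => // j.
  by have /closeP := xy i; apply=> //; rewrite mul1r.
by rewrite mul1r; apply: xy.
Qed.

Lemma left_expansiveP : left_expansive d phi <-> expansive (- 1) phi.
Proof.
rewrite -(metric_expansive _ ephi) //; split=> -[r r0 ex]; exists r =>
  // x y xo yo xy; apply: ex => // i; first move=> j j0; last apply/closeP => // j.
  by have /closeP := xy i; apply=> //; rewrite mulN1r oppr_ge0.
by rewrite mulN1r oppr_ge0; apply: xy.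
Qed.

Lemma positively_right_expansiveP :
  positively_right_expansive d phi <-> positively_expansive 1 phi.
Proof.
rewrite -(metric_positively_expansive _ ephi) //; split=> -[r r0 ex]; exists r =>
  // x y xy; apply: ex => // i; first move=> j j0; last apply/closeP => // j.
  by have /closeP := xy i; apply=> //; rewrite mul1r.
by rewrite mul1r; apply: xy.
Qed.

Lemma positively_left_expansiveP :
  positively_left_expansive d phi <-> positively_expansive (- 1) phi.
Proof.
rewrite -(metric_positively_expansive _ ephi) //; split=> -[r r0 ex]; exists r =>
  // x y xy; apply: ex => // i; first move=> j j0; last apply/closeP => // j.
  by have /closeP := xy i; apply=> //; rewrite mulN1r oppr_ge0.
by rewrite mulN1r oppr_ge0; apply: xy.
Qed.

End Metric.

(** * Block graphs and textile systems *)

Section BlockGraph.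
Variables (A : finType) (X : subshift A) (C : finType) (c : X -> fullshift C).
Hypothesis c_sigma : forall i x j, c (sigma i x) j = c x (j + i).

(** The coding [c] will be the inclusion of [X] or the pairing of a point with its image, so one
    construction yields both graphs of a textile system. *)
Definition block n (x : X) (i : int) : {ffun 'I_n -> C} :=
  [ffun k : 'I_n => c x (i + (k : nat)%:Z)].

Definition language n : finType :=
  {w : {ffun 'I_n -> C} | `[< exists x, w = block n x 0 >]}.

Lemma block_occurs n x i : `[< exists y, block n x i = block n y 0 >].
Proof.
apply/asboolP; exists (sigma i x); apply/ffunP => k; rewrite !ffunE c_sigma.
by congr (c x _); lia.
Qed.

Definition wd n x i : language n := exist _ (block n x i) (block_occurs n x i).

Lemma wd_eq n x y i j : wd n x i = wd n y j <->
  forall k : nat, (k < n)%N -> c x (i + k%:Z) = c y (j + k%:Z).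
Proof.
split=> [/(congr1 val)/= /ffunP xy k kn|xy].
  by have := xy (Ordinal kn); rewrite !ffunE.
by apply: val_inj => /=; apply/ffunP => k; rewrite !ffunE xy.
Qed.

Lemma wd_sigma n x i j : wd n (sigma i x) j = wd n x (j + i).
Proof. by apply/wd_eq => k _; rewrite c_sigma; congr (c x _); lia. Qed.

Definition rep n (w : language n) : X := projT1 (cid (asboolW (valP w))).

Lemma repK n (w : language n) : wd n (rep w) 0 = w.
Proof. by apply: val_inj => /=; rewrite /rep; case: cid. Qed.

Variable L : nat.

(** The higher block graph: the end vertices of an arc are its prefix and suffix of length [L], read
    off on a representative. *)
Definition block_graph : graph (language L.+1) :=
  @Graph (language L.+1) (language L) (fun w => wd L (rep w) 0)
    (fun w => wd L (rep w) 1).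

Lemma init_wd x i : init block_graph (wd L.+1 x i) = wd L x i.
Proof.
have /wd_eq xw := repK (wd L.+1 x i).
by apply/wd_eq => k kL; rewrite xw // ltnW.
Qed.

Lemma term_wd x i : term block_graph (wd L.+1 x i) = wd L x (i + 1).
Proof.
have /wd_eq xw := repK (wd L.+1 x i).
apply/wd_eq => k kL; have := xw k.+1 kL; rewrite add0r.
have -> : k.+1%:Z = 1 + k%:Z by lia.
by rewrite addrA.
Qed.

Lemma block_graph_nondegenerate : Defs.nondegenerate block_graph.
Proof.
split=> v; first by exists (wd L.+1 (rep v) 0); rewrite init_wd repK.
by exists (wd L.+1 (rep v) (- 1)); rewrite term_wd addNr repK.
Qed.

Definition block_path x : fullshift (language L.+1) := fun j => wd L.+1 x j.

Lemma block_path_paths x : paths block_graph (block_path x).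
Proof. by move=> j; rewrite /block_path term_wd init_wd. Qed.

Lemma block_path_inj x y : block_path x = block_path y -> forall j, c x j = c y j.
Proof.
move=> xy j; have /wd_eq := congr1 (fun z => z j) xy.
by move=> /(_ 0%N isT); rewrite addr0.
Qed.

Definition finite_step : Prop := forall a : fullshift C,
  (forall j, exists x, forall k : nat, (k <= L)%N -> a (j + k%:Z) = c x (j + k%:Z)) ->
  exists x, forall j, c x j = a j.

(** Consecutive arcs overlap in [L] letters, so the first letters of the arcs spell a sequence whose
    words of length [L.+1] all occur. *)
Lemma block_path_surj z : finite_step -> paths block_graph z ->
  exists x, z = block_path x.
Proof.
move=> step Pz; pose a : fullshift C := fun j => c (rep (z j)) 0.
have az k j : (k <= L)%N -> a (j + k%:Z) = c (rep (z j)) k%:Z.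
  elim: k j => [|k IH] j kL; first by rewrite addr0.
  have -> : j + k.+1%:Z = j + 1 + k%:Z by lia.
  rewrite IH 1?ltnW //; have /wd_eq := Pz j => /(_ k kL).
  by rewrite add0r => <-; congr (c _ _); lia.
have [x xa] : exists x, forall j, c x j = a j.
  apply: step => j; exists (sigma (- j) (rep (z j))) => k kL.
  by rewrite az // c_sigma; congr (c _ _); lia.
exists x; apply/funext => j; rewrite -[LHS]repK; apply/wd_eq => k kL.
by rewrite xa az // add0r.
Qed.

End BlockGraph.

Section Textile.
Variables (A : finType) (X : subshift A) (phi : X -> X).
Hypothesis ephi : endomorphism phi.

Definition pairing (x : X) : fullshift (A * A)%type :=
  fun j => (\val x j, \val (phi x) j).

Lemma pairing_sigma i x j : pairing (sigma i x) j = pairing x (j + i).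
Proof. by rewrite /pairing (equivariant ephi.2). Qed.

Lemma pairing_eq x y j : pairing x j = pairing y j <->
  \val x j = \val y j /\ \val (phi x) j = \val (phi y) j.
Proof. by rewrite /pairing; split=> [[xy fxy]|[-> ->]] //; split. Qed.

Lemma pairing_fst x j : \val (id x) j = fst (pairing x j).
Proof. by []. Qed.

Lemma pairing_snd x j : \val (phi x) j = snd (pairing x j).
Proof. by []. Qed.

Variable L : nat.

Let Gamma := block_graph pairing_sigma L.

(* The map [h] is the identity for [p] and [phi] for [q], and [pi] is the
   corresponding projection of [A * A]. *)
Section Letters.
Variables (h : X -> X) (pi : A * A -> A).
Hypothesis h_pi : forall x j, \val (h x) j = pi (pairing x j).

Lemma h_sigma i x : h (sigma i x) = sigma i (h x).
Proof. by apply: eq_point => j; rewrite h_pi pairing_sigma -h_pi. Qed.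

(** The uniqueness half of resolvingness: over the [L] pairs next to it on side [e], a pair is
    determined by its projection. *)
Definition resolves (e : int) : Prop := forall x y : X,
  (forall j : int, 1 <= j <= L%:Z -> pairing x (e * j) = pairing y (e * j)) ->
  pi (pairing x 0) = pi (pairing y 0) -> pairing x 0 = pairing y 0.

(** The existence half: each one-letter extension of the projected block is realized above the
    block. *)
Definition covers (e : int) : Prop := forall x y : X,
  (forall j : int, 1 <= j <= L%:Z -> \val (h x) (e * j) = \val y (e * j)) ->
  exists x', (forall j : int, 1 <= j <= L%:Z ->
    pairing x' (e * j) = pairing x (e * j)) /\ \val (h x') 0 = \val y 0.

Section OneVertex.
Variable (k : 'I_L.+1).

(** Weak resolvingness compares vertices of the domain only, so a single vertex suffices in the
    codomain. *)
Definition one_vertex : graph A := @Graph A unit (fun=> tt) (fun=> tt).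

(** The position [k] will be the end left open by the given vertex: [ord0] under a terminal vertex,
    [ord_max] under an initial one. *)
Definition letter_hom : graph_hom Gamma one_vertex :=
  @GraphHom _ _ Gamma one_vertex (fun w => pi (\val w k)) (fun=> tt)
    (fun=> erefl) (fun=> erefl).

Lemma letter_hom_wd x i :
  letter_hom (wd pairing_sigma L.+1 x i) = \val (h x) (i + (k : nat)%:Z).
Proof. by rewrite h_pi /= ffunE. Qed.

Lemma induced_letter_hom x : induced letter_hom (block_path pairing_sigma L x) =
  \val (sigma (k : nat)%:Z (h x)).
Proof. by apply/funext => j; rewrite /induced letter_hom_wd val_sigma. Qed.

End OneVertex.

Lemma weakly_left_letter : resolves 1 -> weakly_left_resolving (letter_hom ord0).
Proof.
move=> res b b'; rewrite -(repK pairing_sigma b) -(repK pairing_sigma b').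
rewrite !term_wd !letter_hom_wd !h_pi add0r addr0 => /wd_eq xy xy0.
have near (j : int) : 1 <= j <= L%:Z ->
    pairing (rep b) j = pairing (rep b') j.
  move=> jL; have := xy (absz (j - 1)); have -> : 1 + (absz (j - 1))%:Z = j by lia.
  by apply; lia.
apply/wd_eq => -[_|i iL]; last by rewrite add0r; apply: near; lia.
by rewrite addr0; apply: res => // j jL; rewrite mul1r; apply: near.
Qed.

Lemma weakly_right_letter : resolves (- 1) ->
  weakly_right_resolving (letter_hom ord_max).
Proof.
move=> res b b'; rewrite -(repK pairing_sigma b) -(repK pairing_sigma b').
rewrite !init_wd !letter_hom_wd !h_pi add0r => /wd_eq xy xy0.
apply/wd_eq => i; rewrite ltnS leq_eqVlt => /predU1P[->|]; last exact: xy.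
have := res (sigma L%:Z (rep b)) (sigma L%:Z (rep b')).
rewrite !pairing_sigma add0r; apply=> // j jL; rewrite !pairing_sigma mulN1r.
have := xy (absz (L%:Z - j)); rewrite add0r.
have -> : (absz (L%:Z - j))%:Z = - j + L%:Z by lia.
by apply; lia.
Qed.

Let G := block_graph (@val_sigma A X) L.

Definition block_arc n (w : language pairing n) : language (fun x : X => \val x) n :=
  wd (@val_sigma A X) n (h (rep w)) 0.

Lemma block_arc_wd n x i :
  block_arc (wd pairing_sigma n x i) = wd (@val_sigma A X) n (h x) i.
Proof.
apply/wd_eq => k kn; rewrite !h_pi; congr pi.
have /wd_eq xw := repK pairing_sigma (wd pairing_sigma n x i).
exact: xw.
Qed.

Lemma block_hom_init b : init G (block_arc b) = block_arc (init Gamma b).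
Proof.
by rewrite -(repK pairing_sigma b) block_arc_wd !init_wd block_arc_wd.
Qed.

Lemma block_hom_term b : term G (block_arc b) = block_arc (term Gamma b).
Proof.
by rewrite -(repK pairing_sigma b) block_arc_wd !term_wd block_arc_wd.
Qed.

Definition block_hom : graph_hom Gamma G :=
  @GraphHom _ _ Gamma G (@block_arc L.+1) (@block_arc L) block_hom_init
    block_hom_term.

Lemma induced_block_hom x : induced block_hom (block_path pairing_sigma L x) =
  block_path (@val_sigma A X) L (h x).
Proof. by apply/funext => j; rewrite /induced [LHS]block_arc_wd. Qed.

Lemma left_resolving_block : resolves 1 -> covers 1 -> left_resolving block_hom.
Proof.
move=> res cov u a; rewrite -(repK pairing_sigma u) -(repK (@val_sigma A X) a).
rewrite term_wd [on_vertex _ _]block_arc_wd => /wd_eq au.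
(* Shifted by [- 1], the word [u] occupies the positions 1 to [L], and the missing letter is at
   0. *)
have [|x [xu xa]] := cov (sigma (- 1) (rep u)) (rep a).
  move=> j jL; rewrite mul1r h_sigma val_sigma.
  have := au (absz (j - 1)); rewrite add0r.
  have -> : 1 + (absz (j - 1))%:Z = j by lia.
  have -> : (absz (j - 1))%:Z = j - 1 by lia.
  by rewrite add0r => -> //; lia.
have ux : wd pairing_sigma L x 1 = wd pairing_sigma L (rep u) 0.
  apply/wd_eq => k kL; have := xu (1 + k%:Z); rewrite mul1r pairing_sigma.
  have -> : 1 + k%:Z - 1 = 0 + k%:Z by lia.
  by apply; lia.
have ax : wd (@val_sigma A X) L.+1 (h x) 0 = wd (@val_sigma A X) L.+1 (rep a) 0.
  apply/wd_eq => -[_|k kL]; first by rewrite addr0.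
  have /wd_eq := ux => /(_ k kL); rewrite add0r.
  have := au k kL; rewrite add0r.
  have -> : 1 + k%:Z = k.+1%:Z by lia.
  by rewrite add0r !h_pi => -> ->.
exists (wd pairing_sigma L.+1 x 0); split.
  by rewrite [block_hom _]block_arc_wd term_wd add0r.
move=> b; rewrite -(repK pairing_sigma b) [block_hom _]block_arc_wd term_wd add0r.
move=> [ba bu]; have /wd_eq xb : wd pairing_sigma L x 1 = wd pairing_sigma L (rep b) 1.
  by rewrite ux bu.
apply/wd_eq => -[_|k kL]; last first.
  by have := xb k kL; rewrite add0r; have -> : 1 + k%:Z = k.+1%:Z by lia.
rewrite addr0; apply: res => [j jL|].
  rewrite mul1r; have := xb (absz (j - 1)).
  have -> : 1 + (absz (j - 1))%:Z = j by lia.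
  by apply; lia.
rewrite -!h_pi xa; have /wd_eq := ba => /(_ 0%N isT).
by rewrite addr0 => ->.
Qed.

Lemma right_resolving_block : resolves (- 1) -> covers (- 1) ->
  right_resolving block_hom.
Proof.
move=> res cov u a; rewrite -(repK pairing_sigma u) -(repK (@val_sigma A X) a).
rewrite init_wd [on_vertex _ _]block_arc_wd => /wd_eq au.
(* Shifted by [L], the word [u] occupies the positions [- L] to [- 1], and the missing letter is at
   0. *)
have [|x [xu xa]] := cov (sigma L%:Z (rep u)) (sigma L%:Z (rep a)).
  move=> j jL; rewrite mulN1r h_sigma !val_sigma.
  have := au (absz (L%:Z - j)); rewrite add0r.
  have -> : (absz (L%:Z - j))%:Z = - j + L%:Z by lia.
  by move=> ->//; lia.
have ux : wd pairing_sigma L x (- L%:Z) = wd pairing_sigma L (rep u) 0.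
  apply/wd_eq => k kL; have := xu (L%:Z - k%:Z).
  rewrite mulN1r pairing_sigma opprB add0r.
  have -> : k%:Z - L%:Z + L%:Z = k%:Z by lia.
  by rewrite [- _ + _]addrC; apply; lia.
have ax : wd (@val_sigma A X) L.+1 (h x) (- L%:Z) = wd (@val_sigma A X) L.+1 (rep a) 0.
  apply/wd_eq => k; rewrite ltnS leq_eqVlt => /predU1P[->|kL].
    by rewrite addNr xa val_sigma.
  have /wd_eq := ux => /(_ k kL); have := au k kL.
  by rewrite !add0r !h_pi => -> ->.
exists (wd pairing_sigma L.+1 x (- L%:Z)); split.
  by rewrite [block_hom _]block_arc_wd init_wd.
move=> b; rewrite -(repK pairing_sigma b) [block_hom _]block_arc_wd init_wd.
move=> [ba bu].
have /wd_eq xb : wd pairing_sigma L x (- L%:Z) = wd pairing_sigma L (rep b) 0.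
  by rewrite ux bu.
apply/wd_eq => k; rewrite ltnS leq_eqVlt => /predU1P[->|]; last exact: xb.
rewrite addNr; have := res x (sigma L%:Z (rep b)); rewrite pairing_sigma; apply.
  move=> j jL; rewrite mulN1r pairing_sigma.
  have := xb (absz (L%:Z - j)).
  have -> : (absz (L%:Z - j))%:Z = - j + L%:Z by lia.
  have -> : - L%:Z + (- j + L%:Z) = - j by lia.
  by rewrite add0r; apply; lia.
rewrite -!h_pi xa val_sigma; have /wd_eq := ba => /(_ L (ltnSn L)) ->.
by [].
Qed.

End Letters.
End Textile.

(** * Recoded subshifts and stacks of iterates *)

Lemma ultra_forall (B : finType) (P : B -> nat -> Prop) :
  (forall b, ultra [set n | P b n]) -> ultra [set n | forall b, P b n].
Proof.
move=> uP; suff : ultra [set n | forall b, b \in enum B -> P b n].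
  by apply: filterS => n nP b; apply: nP; rewrite mem_enum.
elim: (enum B) => [|b s IH]; first by apply: filterS filterT.
apply: filterS (filterI (uP b) IH) => n [/= nb ns] b'.
by rewrite inE => /predU1P[->|/ns].
Qed.

Section Image.
Variables (A : finType) (X : subshift A) (C : finType) (c : X -> fullshift C).
Hypothesis c_sigma : forall i x j, c (sigma i x) j = c x (j + i).
Hypothesis c_plim : forall (u : nat -> X) j,
  ultra [set n | c (u n) j = c (plim u) j].

Lemma image_closed : closed [set b | exists x, b = c x].
Proof.
apply: closed_ulim => u /choice[x ux]; exists (plim x).
by apply: ulim_uniq => j; apply: filterS (c_plim x j) => n /= <-; rewrite ux.
Qed.

Lemma image_shift :
  Defs.shift 1 @` [set b | exists x, b = c x] = [set b | exists x, b = c x].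
Proof.
have cS x i : Defs.shift i (c x) = c (sigma i x).
  by apply/funext => j; rewrite c_sigma.
apply/seteqP; split=> [_ [_ [x ->] <-]|_ [x ->]].
  by exists (sigma 1 x); rewrite cS.
by exists (c (sigma (- 1) x)); [exists (sigma (- 1) x)|rewrite cS sigmaVK].
Qed.

Definition image_subshift : subshift C := Subshift image_closed image_shift.

Definition to_image (x : X) : image_subshift :=
  point (X := image_subshift) (ex_intro _ x erefl).

Lemma to_image_conjugacy : (forall x y, c x = c y -> x = y) -> conjugacy to_image.
Proof.
move=> cinj; have ts x : to_image (sigma 1 x) = sigma 1 (to_image x).
  by apply: eq_point => j; rewrite /= c_sigma.
apply: bijective_conjugacy => //; last 2 first.
- by move=> x y /(congr1 val)/= /cinj.
- move=> y; have [x yx] := pointP y.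
  by exists x; apply: val_inj; rewrite /= -yx.
apply: continuous_block => //.
apply: (@compactness _ _ (fun k x y => agree_upto k (\val x) (\val y))
  (fun x y => c x 0 = c y 0)).
- by move=> k l x y kl xy j jk; apply: xy; lia.
- move=> k u v uv j jk; apply: plim_eq_at.
  by apply: filterS uv => n; apply.
- move=> u v uv; apply: filterS (filterI (c_plim u 0) (c_plim v 0)) => n [/= -> ->].
  exact: uv.
- move=> x y xy; suff -> : x = y by [].
  by apply: eq_point => j; apply: (xy (absz j) j); lia.
Qed.

End Image.

Lemma endomorphism_conj (A B : finType) (X : subshift A) (Y : subshift B)
    (theta : X -> Y) (g : Y -> X) (phi : X -> X) :
  conjugacy theta -> conjugacy g -> endomorphism phi ->
  endomorphism (theta \o phi \o g).
Proof.
move=> [[tc _] ts] [[gc _] gs] [phic phis]; split=> x.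
  apply: (@continuous_comp _ _ _ g (theta \o phi)); first exact: gc.
  by apply: (@continuous_comp _ _ _ phi theta); [exact: phic|exact: tc].
by rewrite /= gs phis ts.
Qed.

Section Stack.
Variables (A : finType) (X : subshift A) (phi : X -> X).
Hypothesis ephi : endomorphism phi.
Variable s : nat.
Hypothesis s0 : (0 < s)%N.

Definition stack (x : X) : fullshift {ffun 'I_s -> A} :=
  fun j => [ffun i : 'I_s => \val (iter i phi x) j].

Lemma stack_sigma i x j : stack (sigma i x) j = stack x (j + i).
Proof.
apply/ffunP => k; rewrite !ffunE (equivariant (endomorphism_iter k ephi).2).
by rewrite val_sigma.
Qed.

Lemma stack_plim (u : nat -> X) j : ultra [set n | stack (u n) j = stack (plim u) j].
Proof.
have : ultra [set n | forall k : 'I_s,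
    \val (iter k phi (u n)) j = \val (iter k phi (plim u)) j].
  apply: ultra_forall => k; rewrite (plim_continuous (endomorphism_iter k ephi).1).
  exact: plimE.
by apply: filterS => n nk; apply/ffunP => k; rewrite !ffunE nk.
Qed.

Lemma stack_inj x y : stack x = stack y -> x = y.
Proof.
move=> xy; apply: eq_point => j.
have := congr1 (fun z : fullshift {ffun 'I_s -> A} => z j (Ordinal s0)) xy.
by rewrite /stack !ffunE.
Qed.

Definition stack_shift := image_subshift stack_sigma stack_plim.

Definition to_stack : X -> stack_shift := to_image stack_sigma stack_plim.

Lemma agree_from_stack e c x y :
  agree_from e c (to_stack x) (to_stack y) <->
  forall i, (i < s)%N -> agree_from e c (iter i phi x) (iter i phi y).
Proof.
split=> [xy i si j cj|xy j cj]; last first.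
  by rewrite /= /stack; apply/ffunP => i; rewrite !ffunE; apply: xy.
have := congr1 (fun w : {ffun 'I_s -> A} => w (Ordinal si)) (xy j cj).
by rewrite /= /stack !ffunE.
Qed.

(** All rows of the stack of [phi x] but the last are rows of the stack of [x], and the last one is
    [iter s phi x]. *)
Lemma stack_determines e : determines e (iter s phi) 0 -> forall x y,
  agree_from e 0 (to_stack x) (to_stack y) ->
  agree_from e 0 (to_stack (phi x)) (to_stack (phi y)).
Proof.
move=> D x y /agree_from_stack xy; apply/agree_from_stack => i si.
rewrite -!iterSr; have [->|si1] := eqVneq i.+1 s; last by apply: xy; lia.
by have := D _ _ (xy 0%N s0); rewrite oppr0.
Qed.

(** Rows of positive index occur in the stack of [phi x]; row 0 is recovered from the last row of
    that stack, [iter s phi x]. *)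
Lemma stack_recovers e : recovers e (iter s phi) 0 -> forall x y a,
  agree_from e a (to_stack x) (to_stack y) ->
  agree_from e 0 (to_stack (phi x)) (to_stack (phi y)) ->
  agree_from e 0 (to_stack x) (to_stack y).
Proof.
move=> E x y a /agree_from_stack xy /agree_from_stack fxy.
apply/agree_from_stack => -[_|i si].
  apply: (E _ _ a); first exact: xy s0.
  have s1 : (s.-1 < s)%N by rewrite prednK.
  by have := fxy _ s1; rewrite -!iterSr prednK.
by have := fxy i (ltnW si); rewrite -!iterSr.
Qed.

End Stack.

(** * Weakly resolving presentations from degrees at least 0 *)

Section Windows.
Variables (A : finType) (X : subshift A) (phi : X -> X).
Hypothesis ephi : endomorphism phi.
Variable e : int.
Hypothesis ee : e * e = 1.

Lemma pairing_plim (u : nat -> X) j :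
  ultra [set n | pairing phi (u n) j = pairing phi (plim u) j].
Proof.
rewrite /pairing (plim_continuous ephi.1).
apply: filterS (filterI (plimE u j) (plimE (fun n => phi (u n)) j)) => n [xn fn].
by congr pair.
Qed.

(** The bound holds for all larger [L], so that it can later be combined with the memory of a
    subshift of finite type. *)
Lemma near_compactness (T : X -> X -> Prop) :
  (forall u v, T (plim u) (plim v) -> ultra [set n | T (u n) (v n)]) ->
  (forall x y : X,
    (forall j, 1 <= j -> pairing phi x (e * j) = pairing phi y (e * j)) -> T x y) ->
  exists M : nat, forall L x y, (M <= L)%N ->
    (forall j : int, 1 <= j <= L%:Z ->
      pairing phi x (e * j) = pairing phi y (e * j)) -> T x y.
Proof.
move=> Topen Tall.
have [M MT] : exists M : nat, forall x y, (forall j : int, 1 <= j <= M%:Z ->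
      pairing phi x (e * j) = pairing phi y (e * j)) -> T x y.
  apply: (@compactness _ _ (fun M x y => forall j : int, 1 <= j <= M%:Z ->
      pairing phi x (e * j) = pairing phi y (e * j))) => //.
  - by move=> k l x y kl xy j jk; apply: xy; lia.
  - move=> k u v uv j jk; apply: ultra_const.
    apply: filterS (filterI uv (filterI (pairing_plim u (e * j))
      (pairing_plim v (e * j)))) => n [/= /(_ j jk) uvj [<- <-]].
    exact: uvj.
  - by move=> x y xy; apply: Tall => j j1; apply: (xy (absz j)); lia.
by exists M => L x y ML xy; apply: MT => j jM; apply: xy; lia.
Qed.

Lemma determines_resolves : determines e phi 0 ->
  exists M : nat, forall L, (M <= L)%N -> resolves phi L fst e.
Proof.
move=> D; have [||M MT] := near_compactness (T := fun x y =>
    \val x 0 = \val y 0 -> \val (phi x) 0 = \val (phi y) 0).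
- move=> u v; rewrite !(plim_continuous ephi.1) => uv.
  (* An implication between clopen conditions is open: near the limit either the conclusion holds or
     the premise fails. *)
  have [uv0|uv0] := pselect (\val (plim u) 0 = \val (plim v) 0).
    by apply: filterS (eq_at_open (uv uv0)) => n /= -> .
  apply: filterS (filterI (plimE u 0) (plimE v 0)) => n [un vn] uvn.
  by case: uv0; rewrite -[LHS]un uvn [LHS]vn.
- move=> x y xy xy0; have := D x y; rewrite oppr0 => /(_ _ 0).
  rewrite mulr0; apply=> // j j0.
  have [->|j1] := eqVneq j 0; first by rewrite mulr0.
  by have /pairing_eq[] := xy j ltac:(lia).
- exists M => L ML x y xy xy0; apply/pairing_eq; split=> //.
  exact: MT xy xy0.
Qed.

Lemma recovers_resolves : recovers e phi 0 ->
  exists M : nat, forall L, (M <= L)%N -> resolves phi L snd e.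
Proof.
move=> E; have [||M MT] := near_compactness (T := fun x y =>
    \val (phi x) 0 = \val (phi y) 0 -> \val x 0 = \val y 0).
- move=> u v; rewrite !(plim_continuous ephi.1) => uv.
  have [uv0|uv0] := pselect (\val (plim (fun n => phi (u n))) 0 =
                             \val (plim (fun n => phi (v n))) 0).
    by apply: filterS (eq_at_open (uv uv0)) => n /= -> .
  apply: filterS (filterI (plimE (fun n => phi (u n)) 0)
    (plimE (fun n => phi (v n)) 0)) => n [un vn] uvn.
  by case: uv0; rewrite -[LHS]un uvn [LHS]vn.
- move=> x y xy xy0; have := E x y 1; move=> /(_ _ _ 0).
  rewrite mulr0; apply=> // j j0.
    by have /pairing_eq[] := xy j j0.
  have [->|j1] := eqVneq j 0; first by rewrite mulr0.
  by have /pairing_eq[] := xy j ltac:(lia).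
- exists M => L ML x y xy xy0; apply/pairing_eq; split=> //.
  exact: MT xy xy0.
Qed.

End Windows.

Section WeaklyConverse.
Variables (A : finType) (X : subshift A) (phi : X -> X).
Hypothesis ephi : endomorphism phi.
Variable L : nat.

Lemma block_path_plim (u : nat -> X) j : ultra
  [set n | block_path (pairing_sigma ephi) L (u n) j =
           block_path (pairing_sigma ephi) L (plim u) j].
Proof.
have : ultra [set n | forall k : 'I_L.+1, pairing phi (u n) (j + (k : nat)%:Z) =
    pairing phi (plim u) (j + (k : nat)%:Z)].
  by apply: ultra_forall => k; apply: pairing_plim.
by apply: filterS => n nk; apply/wd_eq => k kL; exact: (nk (Ordinal kL)).
Qed.

Lemma block_path_sigma i x j : block_path (pairing_sigma ephi) L (sigma i x) j =
  block_path (pairing_sigma ephi) L x (j + i).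
Proof. exact: wd_sigma. Qed.

Definition block_shift := image_subshift block_path_sigma block_path_plim.

(** Both projections read the same position [k], so the shift by [k] cancels. *)
Lemma presented_letter k : presented_by
  (Textile (letter_hom ephi fst k) (letter_hom ephi snd k)) block_shift phi.
Proof.
have pE x : induced (letter_hom ephi fst k) (block_path (pairing_sigma ephi) L x) =
    \val (sigma (k : nat)%:Z x).
  exact: (induced_letter_hom ephi (pairing_fst phi)).
have qE x : induced (letter_hom ephi snd k) (block_path (pairing_sigma ephi) L x) =
    \val (sigma (k : nat)%:Z (phi x)).
  exact: (induced_letter_hom ephi (pairing_snd phi)).
split=> [z z' /set_mem[x ->] /set_mem[y ->]||_ [_ [x ->] <-]|z x [y ->]] /=.
- rewrite !pE => /val_inj/(congr1 (sigma (- (k : nat)%:Z))).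
  by rewrite !sigmaK => ->.
- apply/seteqP; split=> [_ [_ [x ->] <-]|a Xa]; first by rewrite pE; apply: pointP.
  exists (block_path (pairing_sigma ephi) L (sigma (- (k : nat)%:Z) (point Xa))).
    by exists (sigma (- (k : nat)%:Z) (point Xa)).
  by rewrite pE sigmaVK.
- by rewrite qE; apply: pointP.
- by rewrite pE qE -(equivariant ephi.2) => /val_inj ->.
Qed.

Lemma block_shift_paths : block_shift `<=` paths (block_graph (pairing_sigma ephi) L).
Proof. by move=> _ [x ->]; apply: block_path_paths. Qed.

End WeaklyConverse.

Section WeaklyOf.
Variables (A : finType) (X : subshift A) (phi : X -> X).
Hypothesis ephi : endomorphism phi.

Lemma determines_weakly_pL : determines 1 phi 0 -> weakly pL phi.
Proof.
move=> /(determines_resolves ephi)[//|M MR].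
exists _, (Textile (letter_hom ephi fst (ord0 : 'I_M.+1))
    (letter_hom ephi snd ord0)),
  (block_shift ephi M); split; last exact: presented_letter.
  exact: (weakly_left_letter (pairing_fst phi) (MR M (leqnn M))).
exact: block_shift_paths.
Qed.

Lemma determines_weakly_pR : determines (- 1) phi 0 -> weakly pR phi.
Proof.
move=> /(determines_resolves ephi)[//|M MR].
exists _, (Textile (letter_hom ephi fst (ord_max : 'I_M.+1))
    (letter_hom ephi snd ord_max)),
  (block_shift ephi M); split; last exact: presented_letter.
  exact: (weakly_right_letter (pairing_fst phi) (MR M (leqnn M))).
exact: block_shift_paths.
Qed.

Lemma recovers_weakly_qL : recovers 1 phi 0 -> weakly qL phi.
Proof.
move=> /(recovers_resolves ephi)[//|M MR].
exists _, (Textile (letter_hom ephi fst (ord0 : 'I_M.+1))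
    (letter_hom ephi snd ord0)),
  (block_shift ephi M); split; last exact: presented_letter.
  exact: (weakly_left_letter (pairing_snd phi) (MR M (leqnn M))).
exact: block_shift_paths.
Qed.

Lemma recovers_weakly_qR : recovers (- 1) phi 0 -> weakly qR phi.
Proof.
move=> /(recovers_resolves ephi)[//|M MR].
exists _, (Textile (letter_hom ephi fst (ord_max : 'I_M.+1))
    (letter_hom ephi snd ord_max)),
  (block_shift ephi M); split; last exact: presented_letter.
  exact: (weakly_right_letter (pairing_snd phi) (MR M (leqnn M))).
exact: block_shift_paths.
Qed.

End WeaklyOf.

(** * Degrees at least 0 from presentations *)

Section Presented.
Variables (A B : finType) (X : subshift A) (phi : X -> X) (T : textile B A).
Variable Z : subshift B.
Hypothesis Z_paths : Z `<=` paths (textile_dom T).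
Hypothesis ZT : presented_by T Z phi.

Lemma presented_point (z : Z) : points X (induced (tp T) (\val z)).
Proof.
by have [_ ZX _ _] := ZT; rewrite -ZX; exists (\val z); [exact: pointP|].
Qed.

Definition presented_map (z : Z) : X := point (presented_point z).

Lemma presented_conjugacy : conjugacy presented_map.
Proof.
have ts z : presented_map (sigma 1 z) = sigma 1 (presented_map z).
  exact: eq_point.
apply: bijective_conjugacy => //.
- apply: continuous_block => //; exists 0%N => z z' zz'.
  by rewrite /= /induced zz'.
- have [Tinj _ _ _] := ZT.
  move=> z z' /(congr1 val) zz'; apply: val_inj.
  by apply: Tinj zz'; apply: valP.
- have [_ Tonto _ _] := ZT => x.
  have [z Zz zx] : (induced (tp T) @` Z) (\val x) by rewrite Tonto; apply: pointP.
  exists (point Zz).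
  exact: val_inj.
Qed.

Lemma presented_inverse : exists2 g : X -> Z, conjugacy g & forall x,
  \val x = induced (tp T) (\val (g x)) /\
  \val (phi x) = induced (tq T) (\val (g x)).
Proof.
have [g gc [_ gK]] := conjugacy_sym presented_conjugacy; exists g => // x.
have [_ _ _ Tphi] := ZT; have xg : \val x = induced (tp T) (\val (g x)).
  by rewrite -{1}(gK x).
by split=> //; apply: Tphi; [exact: pointP|rewrite -xg].
Qed.

(** Recovery of degree 0 for the letter map [h] on [Z], the form in which weak resolvingness acts on
    paths. *)
Definition propagates (e : int) (h : B -> A) : Prop := forall (z z' : Z) a,
  agree_from e a z z' ->
  (forall j, 0 <= j -> h (\val z (e * j)) = h (\val z' (e * j))) ->
  agree_from e 0 z z'.

Lemma propagate_down e (h : B -> A) :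
  (forall (z z' : Z) j, 0 <= j -> agree_from e (j + 1) z z' ->
    h (\val z (e * j)) = h (\val z' (e * j)) -> \val z (e * j) = \val z' (e * j)) ->
  propagates e h.
Proof.
move=> step z z' a zza hzz.
have : agree_from e (absz a)%:Z z z' by apply: agree_from_le zza; lia.
elim: (absz a) => // n IH zzn; apply: IH.
have n1 : n%:Z = n.+1%:Z - 1 by lia.
rewrite n1; apply: agree_from_pred => //; rewrite -n1.
apply: step => //; last exact: hzz.
by apply: agree_from_le zzn; lia.
Qed.

Lemma weakly_left_propagates (h : graph_hom (textile_dom T) (textile_cod T)) :
  weakly_left_resolving h -> propagates 1 h.
Proof.
move=> wl; apply: propagate_down => z z' j _ zz'; apply: wl.
rewrite (Z_paths (pointP z)) (Z_paths (pointP z')) !mul1r.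
by congr init; have := zz' (j + 1); rewrite !mul1r; apply.
Qed.

Lemma weakly_right_propagates (h : graph_hom (textile_dom T) (textile_cod T)) :
  weakly_right_resolving h -> propagates (- 1) h.
Proof.
move=> wr; apply: propagate_down => z z' j _ zz'; apply: wr.
have jE : - 1 * j = - 1 * (j + 1) + 1 by lia.
by rewrite jE -(Z_paths (pointP z)) -(Z_paths (pointP z')) zz'.
Qed.

Section Side.
Variable e : int.
Hypothesis ee : e * e = 1.

(** The inverse of the projection is a block map, so the points of [Z] above [x] and [y] are
    asymptotic; propagation makes them agree from 0, and their images follow letter by letter. *)
Lemma propagates_determines : propagates e (tp T) -> determines e phi 0.
Proof.
move=> prop x y xy; have [g [[gc _] gs] gE] := presented_inverse.
have [r rg] := agree_from_map ee gc gs; rewrite oppr0.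
have gxy : agree_from e 0 (g x) (g y).
  apply: prop (rg _ _ _ xy) _ => j j0.
  have := xy j j0; rewrite (gE x).1 (gE y).1.
  exact.
by move=> j j0; rewrite (gE x).2 (gE y).2 /induced gxy.
Qed.

Lemma propagates_recovers : propagates e (tq T) -> recovers e phi 0.
Proof.
move=> prop x y a xy fxy; have [g [[gc _] gs] gE] := presented_inverse.
have [r rg] := agree_from_map ee gc gs.
have gxy : agree_from e 0 (g x) (g y).
  apply: prop (rg _ _ _ xy) _ => j j0.
  have := fxy j j0; rewrite (gE x).2 (gE y).2.
  exact.
by move=> j j0; rewrite (gE x).1 (gE y).1 /induced gxy.
Qed.

End Side.

Definition textile_condition (P : resolving_term) : Prop :=
  match P with
  | pL => determines 1 phi 0
  | pR => determines (- 1) phi 0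
  | qL => recovers 1 phi 0
  | qR => recovers (- 1) phi 0
  end.

Lemma presented_condition P : textile_weakly P T -> textile_condition P.
Proof.
case: P => /= PT.
- exact/propagates_determines/weakly_left_propagates.
- exact/propagates_determines/weakly_right_propagates.
- exact/propagates_recovers/weakly_left_propagates.
- exact/propagates_recovers/weakly_right_propagates.
Qed.

End Presented.

(** * Subshifts of finite type *)

Section FiniteType.
Variables (A : finType) (X : subshift A).

Definition of_finite_step (L : nat) : Prop := finite_step (fun x : X => \val x) L.

(** The windows of [a] are carried to the Markov shift and patched there: being a path only concerns
    consecutive arcs. The inverse conjugacy brings the path back. *)
Lemma SFT_finite_step : SFT X ->
  exists N : nat, forall L, (N <= L)%N -> of_finite_step L.
Proof.
move=> [B [G [theta [_ thetac]]]].
have [[tc _] ts] := thetac; have [g [[gc _] gs] [tK gK]] := conjugacy_sym thetac.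
have [r1 rt] := block_map tc ts; have [r2 rg] := block_map gc gs.
(* The radii of [theta] and of its inverse, and 1 for the comparison of consecutive arcs. *)
pose r := (r1 + r2 + 1)%N; exists (r + r)%N => L rL a aX.
have /choice[x xa] j : exists x : X, forall i : int,
    j - r%:Z <= i <= j + r%:Z -> \val x i = a i.
  have [x xa] := aX (j - r%:Z); exists x => i ij.
  have := xa (absz (i - (j - r%:Z))%R).
  have -> : j - r%:Z + (absz (i - (j - r%:Z))%R)%:Z = i by lia.
  by move=> ->//; lia.
pose y : fullshift B := fun i => \val (theta (x i)) i.
have ty i j : j - (r2%:Z + 1) <= i <= j + (r2%:Z + 1) ->
    \val (theta (x j)) i = y i.
  by move=> ij; apply: rt => k ki; rewrite !xa // /r; lia.
have Py : paths G y.
  move=> i; rewrite -(ty (i + 1) i); last lia.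
  exact: (pointP (theta (x i))).
exists (g (point (X := path_shift G) Py)) => j.
rewrite -(xa j j); last lia.
rewrite -[in RHS](tK (x j)); apply: rg => i ij /=.
by rewrite ty //; lia.
Qed.

(** The first components form a point [x]. The second ones are those of [phi x], since each window
    as wide as that of [phi] comes from an actual pair. *)
Lemma pairing_finite_step (phi : X -> X) N : endomorphism phi ->
  (forall L, (N <= L)%N -> of_finite_step L) ->
  exists M : nat, forall L, (M <= L)%N -> finite_step (pairing phi) L.
Proof.
move=> [phic phis] stepN; have [r rphi] := block_map phic phis.
exists (N + r + r)%N => L ML a aX.
have NL : (N <= L)%N by lia.
have [|x xa] := stepN L NL (fun j => (a j).1).
  move=> j; have [x xa] := aX j; exists x => k kL.
  by rewrite xa.
exists x => j; rewrite [RHS]surjective_pairing /pairing xa; congr pair.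
have [y ya] := aX (j - r%:Z).
have yj i : j - r%:Z <= i <= j + r%:Z -> a i = pairing phi y i.
  move=> ij; have := ya (absz (i - (j - r%:Z))%R).
  have -> : j - r%:Z + (absz (i - (j - r%:Z))%R)%:Z = i by lia.
  by apply; lia.
rewrite yj; last lia.
by apply: rphi => i ij; rewrite xa yj.
Qed.

(** Since the overlap has length [L], a word of length [L.+1] in the concatenation lies entirely in
    [x] or entirely in [y]. *)
Lemma glue e L (x y : X) : e * e = 1 -> of_finite_step L ->
  (forall j : int, 1 <= j <= L%:Z -> \val x (e * j) = \val y (e * j)) ->
  exists z : X, (forall j : int, 1 <= j -> \val z (e * j) = \val x (e * j)) /\
    (forall j : int, j <= L%:Z -> \val z (e * j) = \val y (e * j)).
Proof.
move=> ee step xy.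
pose a : fullshift A := fun i => if 1 <= e * i then \val x i else \val y i.
have ax j : 1 <= j -> a (e * j) = \val x (e * j).
  by move=> j1; rewrite /a mulee // j1.
have ay j : j <= L%:Z -> a (e * j) = \val y (e * j).
  move=> jL; rewrite /a mulee //; case: ifP => // j1.
  by apply: xy; rewrite j1.
have [|z za] := step a; last first.
  by exists z; split=> j j1; rewrite za; [apply: ax|apply: ay].
move=> j.
have [all1|nall] := pselect (forall k : nat, (k <= L)%N -> 1 <= e * (j + k%:Z)).
  by exists x => k kL; rewrite -[j + _](mulee ee) ax // all1.
exists y => k kL; rewrite -[j + _](mulee ee) ay //.
rewrite leNgt; apply/negP => Lk; apply: nall => l lL.
by move: Lk; case: (sideP ee) => ->; lia.
Qed.

End FiniteType.

(** * Realizing extensions of blocks *)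

Section Covers.
Variables (A : finType) (X : subshift A) (phi : X -> X).
Hypothesis ephi : endomorphism phi.
Variables (e : int) (L : nat).
Hypothesis ee : e * e = 1.
Hypothesis step : of_finite_step X L.

Lemma determines_covers : determines e phi 0 -> covers phi L id e.
Proof.
move=> D x y /= /(glue ee step)[z [zx zy]]; exists z; split; last first.
  by have := zy 0; rewrite mulr0; apply.
move=> j jL; apply/pairing_eq; split; first by apply: zx; lia.
have := determines_sigma ee ephi D (k := 1) zx; rewrite subr0; apply; lia.
Qed.

(** The glued image is pulled back through [phi], a conjugacy here, so its preimage is asymptotic to
    [x]; degree 0 then recovers [x] from 1 on. *)
Lemma recovers_covers_injective : recovers e phi 0 -> injective phi ->
  onto phi -> covers phi L phi e.
Proof.
move=> E phi_inj phi_onto x y /(glue ee step)[z [zx zy]].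
have [w wz] := phi_onto z; exists w; split; last first.
  by rewrite wz; have := zy 0; rewrite mulr0; apply.
have phiconj := bijective_conjugacy ephi.1 ephi.2 phi_inj phi_onto.
have [g [[gc _] gs] [phiK _]] := conjugacy_sym phiconj.
have [r rg] := agree_from_map ee gc gs.
have fwx : agree_from e 1 (phi w) (phi x) by rewrite wz.
have := rg _ _ _ fwx; rewrite !phiK => wx1.
have wx : agree_from e 1 w x.
  by apply: (recovers_sigma ephi E wx1); rewrite add0r.
by move=> j jL; apply/pairing_eq; split; [apply: wx|apply: fwx]; lia.
Qed.

Section Transitive.
Hypothesis phi_onto : onto phi.
Hypothesis res : resolves phi L snd e.

Definition same_block (x y : X) : Prop := forall j : int, 1 <= j <= L%:Z ->
  pairing phi x (e * j) = pairing phi y (e * j).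

(** Covering at the block of [x], for continuations of every finite length; in this form it passes
    on to the next block. *)
Definition lifting (x : X) : Prop := forall (m : nat) (y : X),
  (forall j : int, 1 <= j <= L%:Z -> \val (phi x) (e * j) = \val y (e * j)) ->
  exists z, same_block z x /\
    (forall j : int, - m%:Z <= j <= 0 -> \val (phi z) (e * j) = \val y (e * j)).

Lemma same_block_sym x y : same_block x y -> same_block y x.
Proof. by move=> xy j jL; rewrite xy. Qed.

Lemma same_block_trans x y z : same_block x y -> same_block y z -> same_block x z.
Proof. by move=> xy yz j jL; rewrite xy ?yz. Qed.

Lemma lifting_same_block x y : same_block x y -> lifting x -> lifting y.
Proof.
move=> xy lx m w yw; have [|z [zx zw]] := lx m w.
  by move=> j jL; have /pairing_eq[_ ->] := xy j jL; apply: yw.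
by exists z; split=> //; apply: same_block_trans xy.
Qed.

Lemma val_sigmaN (x : X) k j :
  \val (sigma (- (e * k)) x) (e * j) = \val x (e * (j - k)).
Proof. by rewrite val_sigma mulrBr. Qed.

Lemma pairing_sigmaN (x : X) k j :
  pairing phi (sigma (- (e * k)) x) (e * j) = pairing phi x (e * (j - k)).
Proof. by rewrite (pairing_sigma ephi) mulrBr. Qed.

Lemma val_sigmaP (x : X) k j : \val (sigma (e * k) x) (e * j) = \val x (e * (j + k)).
Proof. by rewrite val_sigma mulrDr. Qed.

Lemma pairing_sigmaP (x : X) k j :
  pairing phi (sigma (e * k) x) (e * j) = pairing phi x (e * (j + k)).
Proof. by rewrite (pairing_sigma ephi) mulrDr. Qed.

Lemma same_block_back x y (m : nat) : same_block x y ->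
  (forall j : int, - m%:Z <= j <= 0 -> \val (phi x) (e * j) = \val (phi y) (e * j)) ->
  forall j : int, - m%:Z <= j <= L%:Z -> pairing phi x (e * j) = pairing phi y (e * j).
Proof.
move=> xy; elim: m => [|m IH] fxy j jL.
  have [->|j0] := eqVneq j 0; last by apply: xy; lia.
  by rewrite mulr0; apply: res => //; have := fxy 0; rewrite mulr0; apply.
have xyj i : - m%:Z <= i <= L%:Z -> pairing phi x (e * i) = pairing phi y (e * i).
  by apply: IH => k km; apply: fxy; lia.
have [->|j0] := eqVneq j (- m.+1%:Z); last by apply: xyj; lia.
have := res (x := sigma (e * - m.+1%:Z) x) (y := sigma (e * - m.+1%:Z) y).
rewrite !(pairing_sigma ephi) !add0r; apply; last by apply: fxy; lia.
by move=> i iL; rewrite !pairing_sigmaP; apply: xyj; lia.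
Qed.

(** A continuation over the next block is glued to the image of [x] and lifted with one more letter;
    [res] forces the lift through the next block of [x]. *)
Lemma lifting_shift x : lifting x -> lifting (sigma (- (e * 1)) x).
Proof.
move=> lx m y xy; have [w [wx wy]] := glue ee step xy.
have [|z [zx zw]] := lx m.+1 (sigma (e * 1) w).
  move=> j jL; rewrite val_sigmaP wx; last lia.
  by rewrite (equivariant ephi.2) val_sigmaN addrK.
have zx0 : pairing phi z (e * 0) = pairing phi x (e * 0).
  rewrite mulr0; apply: res => //; have := zw 0.
  rewrite val_sigmaP wx // (equivariant ephi.2) val_sigmaN addrK mulr0.
  by apply; lia.
exists (sigma (- (e * 1)) z); split=> [j jL|j jm].
  rewrite !pairing_sigmaN; have [->|j1] := eqVneq j 1; first by rewrite subrr.
  by apply: zx; lia.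
rewrite (equivariant ephi.2) val_sigmaN zw; last lia.
by rewrite val_sigmaP subrK wy //; lia.
Qed.

Definition block_at (x : X) : {ffun 'I_L -> A * A} :=
  [ffun k : 'I_L => pairing phi x (e * (1 + (k : nat)%:Z))].

Lemma block_atP x y : block_at x = block_at y <-> same_block x y.
Proof.
split=> [/ffunP xy j jL|xy]; last first.
  by apply/ffunP => k; rewrite !ffunE; apply: xy; have := ltn_ord k; lia.
have jL' : (absz (j - 1)%R < L)%N by lia.
have := xy (Ordinal jL'); rewrite !ffunE /=.
by have -> : 1 + (absz (j - 1))%:Z = j by lia.
Qed.

(** The blocks next to the side to be continued, in points whose image spells the word of [y] on 1
    to [L + n]. *)
Definition end_blocks (y : X) (n : nat) : {set {ffun 'I_L -> A * A}} :=
  [set v | `[< exists2 x, block_at x = v & forall j : int,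
    1 <= j <= (L + n)%N%:Z -> \val (phi x) (e * j) = \val y (e * j) >]]%SET.

Lemma end_blocksP y n v : reflect (exists2 x, block_at x = v & forall j : int,
    1 <= j <= (L + n)%N%:Z -> \val (phi x) (e * j) = \val y (e * j))
  (v \in end_blocks y n).
Proof. by rewrite inE; apply: asboolP. Qed.

(* Where the number of blocks over [y] is minimal, each of them must lift every
   continuation [z] of [y], since the blocks over [z] inject into those blocks
   over [y] that lift. *)
Lemma lifting_exists : X -> exists x, lifting x.
Proof.
move=> x0; pose P k := `[< exists y n, #|end_blocks y n| = k >].
have exP : exists k, P k.
  by exists #|end_blocks x0 0|; apply/asboolP; exists x0, 0%N.
have [k /asboolP[y [n ynk]] kmin] := ex_minnP exP.
have [x xy] := phi_onto y; exists x => m y' xy'.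
have [|z [zy zy']] := @glue _ _ e L y y' ee step.
  by move=> j jL; rewrite -xy; apply: xy'.
(* The word of [z] on [- m] to [L + n], moved to start at 1, so that minimality of [k] applies to
   it. *)
pose z' := sigma (- (e * m.+1%:Z)) z; pose n' := (n + m.+1)%N.
pose S := [set v | `[< exists2 x, block_at x = v & forall j : int,
    - m%:Z <= j <= (L + n)%N%:Z -> \val (phi x) (e * j) = \val z (e * j) >]]%SET.
have SP v : reflect (exists2 x, block_at x = v & forall j : int,
    - m%:Z <= j <= (L + n)%N%:Z -> \val (phi x) (e * j) = \val z (e * j)) (v \in S).
  by rewrite inE; apply: asboolP.
have Sy : S \subset end_blocks y n.
  apply/fintype.subsetP => v /SP[w wv wz]; apply/end_blocksP; exists w => // j jn.
  by rewrite wz ?zy //; lia.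
pose r v := xget x0 [set x | block_at x = v /\ forall j : int,
    1 <= j <= (L + n')%N%:Z -> \val (phi x) (e * j) = \val z' (e * j)].
have rP v : v \in end_blocks z' n' -> block_at (r v) = v /\ forall j : int,
    1 <= j <= (L + n')%N%:Z -> \val (phi (r v)) (e * j) = \val z' (e * j).
  move=> /end_blocksP[w wv wz].
  exact: (@xgetPex _ x0 [set x | block_at x = v /\ forall j : int,
    1 <= j <= (L + n')%N%:Z -> \val (phi x) (e * j) = \val z' (e * j)]
    (ex_intro _ w (conj wv wz))).
have rz v : v \in end_blocks z' n' -> forall j : int,
    - m%:Z <= j <= (L + n)%N%:Z ->
    \val (phi (sigma (e * m.+1%:Z) (r v))) (e * j) = \val z (e * j).
  move=> /rP[_ rvz] j jm; rewrite (equivariant ephi.2) val_sigmaP rvz.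
    by rewrite val_sigmaN addrK.
  by rewrite /n'; lia.
pose F v := block_at (sigma (e * m.+1%:Z) (r v)).
(* By [same_block_back] the block where the continuation starts and the image determine the block
   where it ends. *)
have Finj : {in end_blocks z' n' &, injective F}.
  move=> v1 v2 v1z v2z /block_atP F12.
  have back := same_block_back (m := m) F12.
  rewrite -(rP v1 v1z).1 -(rP v2 v2z).1; apply/block_atP => j jL.
  have := back _ (j - m.+1%:Z).
  rewrite !pairing_sigmaP subrK; apply; last lia.
  by move=> i im; rewrite !rz //; lia.
have FS : [set F v | v in end_blocks z' n']%SET \subset S.
  apply/fintype.subsetP => _ /imsetP[v vz ->]; apply/SP.
  by exists (sigma (e * m.+1%:Z) (r v)) => //; apply: rz.
(* By minimality [k] is at most the number of blocks over [z'], which inject into [S]. *)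
have cardS : (#|end_blocks y n| <= #|S|)%N.
  apply: leq_trans (subset_leq_card FS); rewrite (card_in_imset Finj) ynk.
  by apply: kmin; apply/asboolP; exists z', n'.
have : block_at x \in end_blocks y n.
  by apply/end_blocksP; exists x => // j _; rewrite xy.
have /eqP <- : S == end_blocks y n by rewrite eqEcard Sy.
move=> /SP[w /block_atP wx wz]; exists w; split=> // j jm.
by rewrite wz ?zy' //; lia.
Qed.

Lemma same_block_open x : open [set y | same_block y x].
Proof.
have [r rphi] := block_map ephi.1 ephi.2.
rewrite openE => y yx; apply/nbhs_subshiftP; exists (L + r)%N => z zy j jL.
rewrite -yx //; apply/pairing_eq; split.
  by apply: zy; case: (sideP ee) => ->; lia.
by apply: rphi => i; case: (sideP ee) => -> ij; apply: zy; lia.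
Qed.

Hypothesis X_transitive : topologically_transitive X.

(** Transitivity provides nonnegative shifts only, so the roles of the two blocks depend on the
    side. *)
Lemma transitive_block x y : exists z (n : nat),
  same_block z x /\ same_block (sigma (- (e * n%:Z)) z) y.
Proof.
have self (u : X) : [set v | same_block v u] !=set0 by exists u.
have [e1|e1] := sideP ee.
  have [n [_ [[u uy <-] ux]]] :=
    X_transitive (same_block_open y) (same_block_open x) (self y) (self x).
  by exists (sigma n%:Z u), n; rewrite [e in e * _]e1 mul1r sigmaK.
have [n [_ [[u ux <-] uy]]] :=
  X_transitive (same_block_open x) (same_block_open y) (self x) (self y).
by exists u, n; rewrite [e in e * _]e1 mulN1r opprK.
Qed.

Lemma recovers_covers_transitive : covers phi L phi e.
Proof.
move=> x y xy; have [x0 lx0] := lifting_exists x.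
have [z [n [zx0 zx]]] := transitive_block x0 x.
have lz : lifting (sigma (- (e * n%:Z)) z).
  elim: {zx} n => [|n IH].
    by rewrite mulr0 oppr0 sigma0; apply: lifting_same_block lx0; apply: same_block_sym.
  have -> : sigma (- (e * n.+1%:Z)) z = sigma (- (e * 1)) (sigma (- (e * n%:Z)) z).
    by rewrite sigmaD; congr (sigma _ z); lia.
  exact: lifting_shift.
have [w [wx wy]] := (lifting_same_block zx lz) 0%N y xy.
by exists w; split=> //; have := wy 0; rewrite mulr0; apply.
Qed.

End Transitive.
End Covers.

(** * The textile system of block graphs *)

Section BlockTextile.
Variables (A : finType) (X : subshift A) (phi : X -> X).
Hypothesis ephi : endomorphism phi.
Hypothesis phi_onto : onto phi.
Variable L : nat.
Hypothesis stepX : of_finite_step X L.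
Hypothesis stepY : finite_step (pairing phi) L.

Let G := block_graph (@val_sigma A X) L.
Let Gamma := block_graph (pairing_sigma ephi) L.

Definition block_p : graph_hom Gamma G := block_hom ephi L (pairing_fst phi).
Definition block_q : graph_hom Gamma G := block_hom ephi L (pairing_snd phi).

Definition to_blocks (x : X) : path_shift G :=
  point (X := path_shift G) (block_path_paths (@val_sigma A X) L x).

Lemma to_blocks_conjugacy : conjugacy to_blocks.
Proof.
have ts x : to_blocks (sigma 1 x) = sigma 1 (to_blocks x).
  by apply: eq_point => j; rewrite val_sigma /= /block_path wd_sigma.
apply: bijective_conjugacy => //.
- apply: continuous_block => //; exists L => x y xy; apply/wd_eq => k kL.
  by apply: xy; lia.
- by move=> x y /(congr1 val)/= /block_path_inj; apply: eq_point.
- move=> z; have [x zx] := block_path_surj stepX (pointP z).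
  by exists x; apply: val_inj; rewrite /= zx.
Qed.

Lemma onto_orbit (x : X) : exists2 y : int -> X, y 0 = x & is_orbit phi y.
Proof.
have [g gK] := choice phi_onto.
exists (fun i => if i is Posz n then iter n phi x else iter (absz i) g x) => //.
move=> [n|n]; first by rewrite -PoszD addn1.
rewrite NegzE /= gK; case: n => [|n]; first by rewrite addNr.
by have -> : - n.+2%:Z + 1 = Negz n by lia.
Qed.

(** Every path of [Gamma] codes some [x] with its image, the pairing being of finite type; as [phi]
    is onto, [x] lies on a two-sided orbit, whose codes weave together. *)
Lemma Z_T_block z : Z_T (Textile block_p block_q) z <->
  exists x, z = block_path (pairing_sigma ephi) L x.
Proof.
split=> [[zs [zsP <- _]]|[x ->]]; first exact: block_path_surj stepY (zsP 0).
have [y <- yo] := onto_orbit x.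
exists (fun i => block_path (pairing_sigma ephi) L (y i)); split=> // i.
  exact: block_path_paths.
rewrite (induced_block_hom ephi L (pairing_snd phi)).
by rewrite (induced_block_hom ephi L (pairing_fst phi)) yo subrK.
Qed.

Lemma essentially_textile P : textile_is P (Textile block_p block_q) ->
  essentially P phi.
Proof.
move=> PT; have tc := to_blocks_conjugacy.
have [g gc [tK gK]] := conjugacy_sym tc.
have pE x : induced block_p (block_path (pairing_sigma ephi) L x) =
    \val (to_blocks x) := induced_block_hom ephi L (pairing_fst phi) x.
have qE x : induced block_q (block_path (pairing_sigma ephi) L x) =
    \val (to_blocks (phi x)) := induced_block_hom ephi L (pairing_snd phi) x.
exists _, G, (to_blocks \o phi \o g), to_blocks; split => //.
- exact: block_graph_nondegenerate.
- split; first exact: endomorphism_conj.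
  move=> z; have [x xz] := phi_onto (g z); exists (to_blocks x).
  by rewrite /= tK xz gK.
- exists _, Gamma, block_p, block_q; split => //.
  split=> [z z' /set_mem/Z_T_block[x ->] /set_mem/Z_T_block[y ->]|
    |_ [_ /Z_T_block[x ->] <-]|z y /Z_T_block[x ->]] /=.
  + by rewrite !pE => /val_inj/(can_inj tK) ->.
  + apply/seteqP; split=> [_ [_ /Z_T_block[x ->] <-]|a Pa].
      by rewrite pE; exact: (pointP (to_blocks x)).
    have [x ax] := block_path_surj stepX Pa.
    exists (block_path (pairing_sigma ephi) L x); first by apply/Z_T_block; exists x.
    by rewrite pE ax.
  + by rewrite qE; exact: (pointP (to_blocks (phi x))).
  + by rewrite pE qE => /val_inj <-; rewrite tK.
- by move=> x; rewrite /= tK.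
Qed.

End BlockTextile.

(** * The set [Z_T] as a subshift *)

Section WovenSet.
Variables (A B : finType) (T : textile B A).

Lemma Z_T_closed : closed (Z_T T).
Proof.
apply: closed_ulim => u /choice[zs zsP].
exists (fun i => ulim (fun n => zs n i)); split=> [i||i].
- apply: ulim_closed; first exact: paths_closed.
  by apply: filterS filterT => n _; have [zP _ _] := zsP n; apply: zP.
- by apply: ulim_uniq => j; apply: filterS (ulimE u j) => n /= <-;
  have [_ -> _] := zsP n.
- apply/funext => j; apply: ultra_const.
  apply: filterS (filterI (ulimE (fun n => zs n (i - 1)) j)
    (ulimE (fun n => zs n i) j)) => n [/= z1 z2].
  have [_ _ /(_ i)/(congr1 (fun z : fullshift A => z j))] := zsP n.
  by rewrite /induced z1 z2.
Qed.

Lemma Z_T_shift : Defs.shift 1 @` Z_T T = Z_T T.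
Proof.
have Zs z k : Z_T T z -> Z_T T (Defs.shift k z).
  move=> [zs [zsP <- zsT]]; exists (fun i => Defs.shift k (zs i)); split=> // i.
    by move=> j; rewrite /Defs.shift (zsP i) addrAC.
  apply/funext => j.
  exact: (congr1 (fun z : fullshift A => z (j + k)) (zsT i)).
apply/seteqP; split=> [_ [z Zz <-]|z Zz]; first exact: Zs.
exists (Defs.shift (- 1) z); first exact: Zs.
by apply/funext => j; rewrite /Defs.shift addrK.
Qed.

Definition woven_shift : subshift B := Subshift Z_T_closed Z_T_shift.

Lemma woven_shift_paths : woven_shift `<=` paths (textile_dom T).
Proof. by move=> z [zs [zsP <- _]]. Qed.

Lemma textile_is_weakly P : textile_is P T -> textile_weakly P T.
Proof.
have left (h : graph_hom (textile_dom T) (textile_cod T)) :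
    left_resolving h -> weakly_left_resolving h.
  move=> hres b c tbc hbc.
  have [|d [_ duniq]] := hres (term _ b) (h b); first exact: hom_term.
  by rewrite -(duniq b) // -(duniq c).
have right (h : graph_hom (textile_dom T) (textile_cod T)) :
    right_resolving h -> weakly_right_resolving h.
  move=> hres b c tbc hbc.
  have [|d [_ duniq]] := hres (init _ b) (h b); first exact: hom_init.
  by rewrite -(duniq b) // -(duniq c).
by case: P => /=; auto.
Qed.

End WovenSet.

Lemma weakly_condition (P : resolving_term) (A : finType) (X : subshift A)
    (phi : X -> X) : weakly P phi -> textile_condition phi P.
Proof.
by move=> [B [T [Z [PT ZT Zphi]]]]; apply: presented_condition ZT Zphi _ PT.
Qed.

Lemma resolving_condition (P : resolving_term) (A : finType) (G : graph A)
    (phi : path_shift G -> path_shift G) :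
  resolving P phi -> textile_condition phi P.
Proof.
move=> [B [Gamma [p [q [PT Zphi]]]]].
apply: (@presented_condition _ _ _ _ (Textile p q) (woven_shift (Textile p q))).
- exact: woven_shift_paths.
- exact: Zphi.
- exact: textile_is_weakly.
Qed.

Lemma condition_weakly (P : resolving_term) (A : finType) (X : subshift A)
    (phi : X -> X) : endomorphism phi -> textile_condition phi P -> weakly P phi.
Proof.
move=> ephi; case: P => /=.
- exact: determines_weakly_pL.
- exact: determines_weakly_pR.
- exact: recovers_weakly_qL.
- exact: recovers_weakly_qR.
Qed.

Lemma condition_essentially (P : resolving_term) (A : finType) (X : subshift A)
    (phi : X -> X) : endomorphism phi -> onto phi -> SFT X ->
  (if P is (qL | qR) then injective phi \/ topologically_transitive X else True) ->
  textile_condition phi P -> essentially P phi.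
Proof.
move=> ephi phi_onto /SFT_finite_step[N stepN].
have [M stepM] := pairing_finite_step ephi stepN.
(* A single [L] exceeds the memories of [X] and of the pairing and the bound for [resolves]. *)
have build K (cond : nat -> Prop) : (forall L, (K <= L)%N -> cond L) ->
    exists L, [/\ of_finite_step X L, finite_step (pairing phi) L & cond L].
  by move=> condK; exists (N + M + K)%N; split;
    [apply: stepN|apply: stepM|apply: condK]; lia.
case: P => /= hP hphi.
- have [|K KR] := determines_resolves ephi _ hphi; first by [].
  have [L [sX sY res]] := build K _ KR.
  apply: (@essentially_textile _ _ _ ephi phi_onto L sX sY).
  apply: left_resolving_block => //.
  exact: determines_covers.
- have [|K KR] := determines_resolves ephi _ hphi; first by [].
  have [L [sX sY res]] := build K _ KR.
  apply: (@essentially_textile _ _ _ ephi phi_onto L sX sY).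
  apply: right_resolving_block => //.
  exact: determines_covers.
- have [|K KR] := recovers_resolves ephi _ hphi; first by [].
  have [L [sX sY res]] := build K _ KR.
  apply: (@essentially_textile _ _ _ ephi phi_onto L sX sY).
  apply: left_resolving_block => //.
  case: hP => hP; [exact: recovers_covers_injective|].
  exact: recovers_covers_transitive.
- have [|K KR] := recovers_resolves ephi _ hphi; first by [].
  have [L [sX sY res]] := build K _ KR.
  apply: (@essentially_textile _ _ _ ephi phi_onto L sX sY).
  apply: right_resolving_block => //.
  case: hP => hP; [exact: recovers_covers_injective|].
  exact: recovers_covers_transitive.
Qed.

(** * Characterization of the resolving classes up to conjugacy *)

Definition side (P : resolving_term) : int := if P is (pL | qL) then 1 else - 1.

Lemma side2 P : side P * side P = 1.
Proof. by case: P. Qed.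

Definition eventually_condition (A : finType) (X : subshift A) (phi : X -> X)
    (P : resolving_term) : Prop :=
  if P is (pL | pR) then eventually_determines (side P) phi
  else eventually_recovers (side P) phi.

Section Eventually.
Variables (P : resolving_term).

Lemma condition_eventually (A : finType) (X : subshift A) (phi : X -> X) :
  endomorphism phi -> textile_condition phi P -> expansive (side P) phi ->
  eventually_condition phi P.
Proof.
move=> ephi; case: P => /= cond ex.
- exact: determines_expansive.
- exact: determines_expansive.
- apply: positively_expansive_eventually_recovers => //.
  exact: recovers_expansive.
- apply: positively_expansive_eventually_recovers => //.
  exact: recovers_expansive.
Qed.

Lemma eventually_expansive (A : finType) (X : subshift A) (phi : X -> X) :
  endomorphism phi -> eventually_condition phi P -> expansive (side P) phi.
Proof.
move=> ephi; case: P => /= cond.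
- exact: eventually_determines_expansive.
- exact: eventually_determines_expansive.
- apply: positively_expansive_expansive.
  exact: eventually_recovers_positively_expansive.
- apply: positively_expansive_expansive.
  exact: eventually_recovers_positively_expansive.
Qed.

Lemma eventually_conj (A B : finType) (X : subshift A) (Y : subshift B)
    (theta : X -> Y) (phi : X -> X) (psi : Y -> Y) :
  endomorphism phi -> endomorphism psi -> conjugacy theta ->
  (forall x, theta (phi x) = psi (theta x)) ->
  eventually_condition psi P -> eventually_condition phi P.
Proof.
(* Recovery is transported through the equivalent positive expansiveness, whose invariance under
   conjugacy only takes a shift. *)
move=> ephi epsi tc pp; have rec e : e * e = 1 -> eventually_recovers e psi ->
    eventually_recovers e phi.
  move=> ee /(eventually_recovers_positively_expansive ee epsi) pe.
  apply: positively_expansive_eventually_recovers => //.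
  exact: positively_expansive_conj tc pp pe.
case: P => /=; [| |exact: rec|exact: rec].
  by apply: eventually_determines_conj epsi tc pp.
by apply: eventually_determines_conj epsi tc pp.
Qed.

Lemma eventually_stack (A : finType) (X : subshift A) (phi : X -> X)
    (ephi : endomorphism phi) : eventually_condition phi P ->
  exists s (g : stack_shift ephi s -> X), [/\ (0 < s)%N, conjugacy g,
    conjugacy (to_stack ephi s), cancel (to_stack ephi s) g /\
    cancel g (to_stack ephi s) &
    textile_condition (to_stack ephi s \o phi \o g) P].
Proof.
have conj s : (0 < s)%N -> conjugacy (to_stack ephi s).
  by move=> s0; apply: to_image_conjugacy; apply: stack_inj.
have det e : eventually_determines e phi ->
  exists s (g : stack_shift ephi s -> X), [/\ (0 < s)%N, conjugacy g,
    conjugacy (to_stack ephi s), cancel (to_stack ephi s) g /\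
    cancel g (to_stack ephi s) & determines e (to_stack ephi s \o phi \o g) 0].
  move=> [s s0 D]; have [g gc [tK gK]] := conjugacy_sym (conj s s0).
  exists s, g; split=> //; first exact: conj.
  move=> x y xy; rewrite oppr0.
  apply: stack_determines => //; first exact: determines_le D.
  by rewrite !gK.
have rec e : eventually_recovers e phi ->
  exists s (g : stack_shift ephi s -> X), [/\ (0 < s)%N, conjugacy g,
    conjugacy (to_stack ephi s), cancel (to_stack ephi s) g /\
    cancel g (to_stack ephi s) & recovers e (to_stack ephi s \o phi \o g) 0].
  move=> [s s0 E]; have [g gc [tK gK]] := conjugacy_sym (conj s s0).
  exists s, g; split=> //; first exact: conj.
  move=> x y a xy fxy; rewrite -(gK x) -(gK y).
  apply: (stack_recovers s0 (recovers_le _ E) (a := a)) => //.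
  by rewrite !gK.
by case: P => /=; [apply: det|apply: det|apply: rec|apply: rec].
Qed.

Section Characterization.
Variables (A : finType) (X : subshift A) (phi : X -> X).
Hypothesis A1 : (1 < #|A|)%N.
Hypothesis ephi : endomorphism phi.

(** A presentation gives degree at least 0 on a conjugate subshift, where expansiveness raises some
    power to degree 1, a property invariant under conjugacy. Conversely, the stack is a conjugate
    subshift with degree at least 0. *)
Lemma essentially_weaklyP :
  essentially_weakly P phi /\ expansive (side P) phi <->
  eventually_condition phi P.
Proof.
split=> [[[A' [X' [phi' [theta [A'1 ephi' wphi' tc tphi]]]]] ex]|ev].
  apply: (eventually_conj ephi ephi' tc tphi).
  apply: condition_eventually => //; first exact: weakly_condition.
  exact: (expansive_conj (side2 P) ephi tc tphi).
split; last exact: eventually_expansive.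
have [s [g [s0 gc tc [tK gK] cond]]] := eventually_stack ephi ev.
have epsi := endomorphism_conj tc gc ephi.
exists {ffun 'I_s -> A}, (stack_shift ephi s), (to_stack ephi s \o phi \o g),
  (to_stack ephi s); split=> //.
- rewrite card_ffun card_ord; apply: leq_trans A1 _.
  by rewrite -{1}[#|A|]expn1 leq_pexp2l // ltnW.
- exact: condition_weakly.
- by move=> x; rewrite /= tK.
Qed.

Hypothesis phi_onto : onto phi.
Hypothesis sft : SFT X.
Hypothesis hP :
  if P is (qL | qR) then injective phi \/ topologically_transitive X else True.

Lemma essentiallyP :
  essentially P phi /\ expansive (side P) phi <-> eventually_condition phi P.
Proof.
split=> [[[A' [G [phi' [theta [_ [ephi' _] rphi' tc tphi]]]]] ex]|ev].
  apply: (eventually_conj ephi ephi' tc tphi).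
  apply: condition_eventually => //; first exact: resolving_condition.
  exact: (expansive_conj (side2 P) ephi tc tphi).
split; last exact: eventually_expansive.
have [s [g [s0 gc tc [tK gK] cond]]] := eventually_stack ephi ev.
have epsi := endomorphism_conj tc gc ephi.
have [|||A' [G [phi' [theta [G1 e1 r1 tc1 t1]]]]] :=
  condition_essentially epsi _ _ _ cond.
- move=> y; have [x xy] := phi_onto (g y); exists (to_stack ephi s x).
  by rewrite /= tK xy gK.
- have [B [G [theta [G1 thetac]]]] := sft; exists B, G, (theta \o g).
  by split=> //; apply: conjugacy_comp.
- have inj : injective phi -> injective (to_stack ephi s \o phi \o g).
    by move=> phi_inj x y /= /(can_inj tK)/phi_inj/(can_inj gK).
  have trans : topologically_transitive X ->
      topologically_transitive (stack_shift ephi s).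
    move=> tX U V oU oV [u Uu] [v Vv].
    have [||||n [_ [[x Ux <-] Vx]]] :=
      tX (to_stack ephi s @^-1` U) (to_stack ephi s @^-1` V).
    - by apply: open_comp oU => ? _; apply: tc.1.1.
    - by apply: open_comp oV => ? _; apply: tc.1.1.
    - by exists (g u); rewrite /preimage /= gK.
    - by exists (g v); rewrite /preimage /= gK.
    exists n, (to_stack ephi s (sigma n%:Z x)); split=> //.
    by exists (to_stack ephi s x) => //; rewrite (equivariant tc.2).
  by case: P hP => //= -[/inj|/trans]; auto.
- exists A', G, phi', (theta \o to_stack ephi s); split=> //.
    exact: conjugacy_comp.
  by move=> x; rewrite /= -t1 /= tK.
Qed.

End Characterization.
End Eventually.

Section Power.
Variables (A : finType) (X : subshift A) (phi : X -> X) (i : nat) (j : int).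

Lemma onto_power_shift : onto phi -> onto (power_shift phi i j).
Proof.
move=> phi_onto y; have [x xy] : exists x, iter i phi x = y.
  elim: i y => [|n IH] y; first by exists y.
  have [z zy] := phi_onto y; have [x xz] := IH z.
  by exists x; rewrite iterS xz.
by exists (sigma (- j) x); rewrite /power_shift sigmaVK.
Qed.

Lemma injective_power_shift : injective phi -> injective (power_shift phi i j).
Proof.
move=> phi_inj x y xy; have : sigma j x = sigma j y.
  by move: xy; rewrite /power_shift; elim: i => //= n IH /phi_inj.
by move=> /(congr1 (sigma (- j))); rewrite !sigmaK.
Qed.

End Power.

(** * Comparison of the slope [j / i] with the limits *)

Section Slopes.
Variables (R : realType) (A : finType) (X : subshift A) (phi : X -> X).
Hypothesis A1 : (1 < #|A|)%N.
Hypothesis ephi : endomorphism phi.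
Variables (i : nat) (j : int).
Hypothesis i0 : (0 < i)%N.
Local Open Scope ereal_scope.

Let slope : \bar R := (j%:~R / i%:R)%:E.
Let A0 : (0 < #|A|)%N := ltnW A1.

Lemma p_L_gt0 : eventually_condition phi pL <-> 0 < p_L R phi.
Proof. by rewrite p_L_rate // determines_rate_gt0. Qed.

Lemma p_R_gt0 : eventually_condition phi pR <-> 0 < p_R R phi.
Proof. by rewrite p_R_rate // determines_rate_gt0. Qed.

Lemma q_L_gt0 : eventually_condition phi qL <-> 0 < q_L R phi.
Proof. by rewrite q_L_rate // recovers_rate_gt0. Qed.

Lemma q_R_gt0 : eventually_condition phi qR <-> 0 < q_R R phi.
Proof. by rewrite q_R_rate // recovers_rate_gt0. Qed.

Lemma p_L_slope :
  eventually_condition (power_shift phi i j) pL <-> - p_L R phi < slope.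
Proof.
rewrite p_L_rate // lteNl -EFinN -mulNr -[j in j%:~R]mul1r.
by rewrite determines_rate_skew.
Qed.

Lemma p_R_slope :
  eventually_condition (power_shift phi i j) pR <-> slope < p_R R phi.
Proof.
rewrite p_R_rate // /slope -[j in j%:~R]opprK -[(- j)%R]mulN1r intrN.
by rewrite determines_rate_skew.
Qed.

Lemma q_R_slope :
  eventually_condition (power_shift phi i j) qR <-> - q_R R phi < slope.
Proof.
rewrite q_R_rate // lteNl -EFinN -mulNr -intrN -[(- j)%R]mulN1r.
by rewrite recovers_rate_skew.
Qed.

Lemma q_L_slope :
  eventually_condition (power_shift phi i j) qL <-> slope < q_L R phi.
Proof.
by rewrite q_L_rate // /slope -[j in j%:~R]mul1r recovers_rate_skew.
Qed.

End Slopes.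

Lemma positively_expansiveP e (A : finType) (X : subshift A) (phi : X -> X) :
  e * e = 1 -> endomorphism phi ->
  positively_expansive e phi <-> eventually_recovers e phi.
Proof.
move=> ee ephi; split; first exact: positively_expansive_eventually_recovers.
exact: eventually_recovers_positively_expansive.
Qed.

Local Open Scope ereal_scope.

Theorem theorem9p7 (R : realType) (A : finType) (hA : (1 < #|A|)%N)
    (X : subshift A) (d : X -> X -> R) (hd : compatible_metric d)
    (phi : X -> X) (hphi : endomorphism phi)
    (i : nat) (hi : (0 < i)%N) (j : int) :
  let psi := power_shift phi i j in
  let slope : \bar R := (j%:~R / i%:R)%:E in
  (onto phi ->
    ((essentially_weakly pL phi /\ right_expansive d phi <-> 0 < p_L R phi) /\
     (essentially_weakly pL psi /\ right_expansive d psi <->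
        - p_L R phi < slope) /\
     (essentially_weakly pR phi /\ left_expansive d phi <-> 0 < p_R R phi) /\
     (essentially_weakly pR psi /\ left_expansive d psi <->
        slope < p_R R phi)) /\
    ((essentially_weakly qR phi /\ left_expansive d phi <-> 0 < q_R R phi) /\
     (essentially_weakly qR psi /\ left_expansive d psi <->
        - q_R R phi < slope) /\
     (essentially_weakly qL phi /\ right_expansive d phi <-> 0 < q_L R phi) /\
     (essentially_weakly qL psi /\ right_expansive d psi <->
        slope < q_L R phi)) /\
    (SFT X ->
      ((essentially pL phi /\ right_expansive d phi <-> 0 < p_L R phi) /\
       (essentially pL psi /\ right_expansive d psi <->
          - p_L R phi < slope) /\
       (essentially pR phi /\ left_expansive d phi <-> 0 < p_R R phi) /\
       (essentially pR psi /\ left_expansive d psi <->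
          slope < p_R R phi)) /\
      (injective phi \/ topologically_transitive X ->
        (essentially qR phi /\ left_expansive d phi <-> 0 < q_R R phi) /\
        (essentially qR psi /\ left_expansive d psi <->
           - q_R R phi < slope) /\
        (essentially qL phi /\ right_expansive d phi <-> 0 < q_L R phi) /\
        (essentially qL psi /\ right_expansive d psi <->
           slope < q_L R phi)))) /\
  ((positively_left_expansive d phi <-> 0 < q_R R phi) /\
   (positively_left_expansive d psi <-> - q_R R phi < slope) /\
   (positively_right_expansive d phi <-> 0 < q_L R phi) /\
   (positively_right_expansive d psi <-> slope < q_L R phi)).
Proof.
move=> psi slope; have hpsi := endomorphism_power_shift hphi i j.
have pos e f : (e * e = 1)%R -> endomorphism f ->
  @positively_expansive e A X f <-> eventually_recovers e f.
  by move=> ee ef; apply: positively_expansiveP.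
split; last first.
  rewrite !(positively_left_expansiveP hd) // !(positively_right_expansiveP hd) //.
  rewrite !pos //.
  split; first exact: q_R_gt0.
  split; first exact: q_R_slope.
  split; first exact: q_L_gt0.
  exact: q_L_slope.
move=> phi_onto; have psi_onto : onto psi := onto_power_shift i j phi_onto.
rewrite !(right_expansiveP hd) // !(left_expansiveP hd) //.
rewrite -(p_L_gt0 R hA hphi) -(p_R_gt0 R hA hphi).
rewrite -(p_L_slope R hA hphi j hi) -(p_R_slope R hA hphi j hi).
rewrite -(q_L_gt0 R hA hphi) -(q_R_gt0 R hA hphi).
rewrite -(q_L_slope R hA hphi j hi) -(q_R_slope R hA hphi j hi).
have weak P f : endomorphism f -> @essentially_weakly P A X f /\
    expansive (side P) f <-> eventually_condition f P.
  by move=> ef; apply: essentially_weaklyP.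
split.
  by split; [apply: (weak pL)|split; [apply: (weak pL)|split; apply: (weak pR)]].
split.
  by split; [apply: (weak qR)|split; [apply: (weak qR)|split; apply: (weak qL)]].
move=> sft; split.
  by split; [|split; [|split]]; [apply: (@essentiallyP pL)|apply: (@essentiallyP pL)
    |apply: (@essentiallyP pR)|apply: (@essentiallyP pR)].
move=> inj_trans.
have inj_trans_psi : injective psi \/ topologically_transitive X.
  by case: inj_trans => [inj|tr]; [left; apply: injective_power_shift|right].
by split; [|split; [|split]]; [apply: (@essentiallyP qR)|apply: (@essentiallyP qR)
  |apply: (@essentiallyP qL)|apply: (@essentiallyP qL)].
Qed.
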